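(* Let $M\{z,w\}$ and $L\{z,w\}$ be the moment and cumulant generating functions associated with a state $\widehat{\phi}$ on $\mathcal{B}$. Let $W$ be a weight function on $S$ with $W(1)=1$ and $W(st)=W(ts)$ for all $s,t\in S$, and let $Q>1/2$. If $\|M\{z,w\}\|_W<2-1/Q$ and $L\{z,0\}\in l^1(S(z),W)$, then the equation $$L\{z,w\}=L\{z,0\}+\bigl(M_{\star}\{z,w\}-M\{z,0\}\bigr)M_{\star}^{-1}\{z,w\}$$ holds in $l^1(S,\widetilde{W})$ (that is, the elements occurring in it belong to $l^1(S,\widetilde{W})$ and the identity holds there), where $\widetilde{W}(s)=W(s)Q^{-m(s)}$ and $m(s)$ is the number of letters $w$ in $s$.
   Context: Words and admissible partitions. $S=FS(\{z,w\})$ is the free semigroup of all finite words in $z,w$ including the empty word $1$; $S^{+}=S\setminus\{1\}$; $S(z)=\{z^n:n\ge0\}$, $S(w)=\{w^n:n\ge0\}$; $l(s)$ is the length of $s$. A subword of $s=s_1\ldots s_n$ is a subsequence $s_{i_1}\ldots s_{i_k}$, $1\le i_1<\ldots<i_k\le n$, with its indices remembered (when a function on $S$ is evaluated at a subword, the subword is regarded simply as a word). A partition of $s\in S^+$ is a sequence $u=(u_1,\ldots,u_p)$ of nonempty subwords with pairwise disjoint index sets whose union is $\{1,\ldots,n\}$, ordered by increasing first index. A letter $s_j$ not belonging to $u_l=s_{i_1}\ldots s_{i_k}$ is inner with respect to $u_l$ if $i_1<j<i_k$. The partition $u$ is admissible if no letter equal to $w$ is inner with respect to any word $u_l$ of $u$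 to which it does not belong. $\mathcal{AP}(s)$ is the set of admissible partitions of $s$. Moments and cumulants. $\mathcal{B}=\mathbf{C}\langle X,X',P\rangle$ is the unital *-algebra of polynomials in noncommuting self-adjoint $X,X'$ and a projection $P$; $X(z)=X$, $X(w)=X'$. For a state $\widehat\phi$ on $\mathcal{B}$: $M(s)=\widehat{\phi}(X(s_1)\cdots X(s_n))$ for $s=s_1\ldots s_n\in S^+$, $M(1)=1$; the admissible cumulants $(L(s))_{s\in S^+}$ are defined recursively by $M(s)=\sum_{p=1}^{l(s)}\sum_{u=(u_1,\ldots,u_p)\in\mathcal{AP}(s)}L(u_1)\cdots L(u_p)$, $s\in S^+$. Semigroup algebra. $\mathcal{A}(S)$ is the algebra of all functions $f:S\to\mathbf{C}$, written as formal sums $\sum_{s\in S}f(s)s$, with pointwise addition and product $(fg)(s)=\sum_{uv=s}f(u)g(v)$; its unit is the indicator of the empty word. An element with $f(1)=1$ is invertible in $\mathcal{A}(S)$. $\mathcal{A}(S(z))$ is defined analogously. A weight function on $S$ is a function $W:S\to(0,\infty)$ with $W(st)\le W(s)W(t)$ for all $s,t\in S$; $l^1(S,W)$ is the Banach algebra of $f:S\to\mathbf{C}$ with $\|f\|_W=\sum_{s\in S}W(s)|f(s)|<\infty$, with the convolution product $(fg)(s)=\sum_{uv=s}f(u)g(v)$; $l^1(S(z),W)$ is defined analogously with sums over $S(z)$. Generating functions. $M\{z,w\}=\sum_{s\in S}\frac{M(s)}{n(s)!}s$ and $L\{z,w\}=\sum_{s\in S^+}\frac{L(s)}{n(s)!}s$,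 where $n(s)!=n_1!n_2!\cdots n_p!$ for $s=z^{n_1}w^{k_1}z^{n_2}w^{k_2}\cdots w^{k_{p-1}}z^{n_p}$ with $n_1,n_p\ge0$ and all other exponents $\ge1$. $M\{z,0\}$, $L\{z,0\}$ denote the restrictions of $M\{z,w\}$, $L\{z,w\}$ to the support $S(z)$. $M^{-1}\{z,0\}$ is the inverse of $M\{z,0\}$. Operation $f_{\star g}$. For $f\in\mathcal{A}(S)$, $g\in\mathcal{A}(S(z))$, $f_{\star g}\in\mathcal{A}(S)$ agrees with $f$ on $S(z)$, and on $S\setminus S(z)$ is given by $$f_{\star g}(z_1w_1z_2w_2\ldots z_{p-1}w_{p-1}z_p)=\sum_{u_1v_1=z_1}\cdots\sum_{u_{p-1}v_{p-1}=z_{p-1}}f(u_1w_1u_2w_2\ldots u_{p-1}w_{p-1}z_p)\,g(v_1)\cdots g(v_{p-1})$$ for $w_1,\ldots,w_{p-1}\in S(w)\setminus\{1\}$, $z_1,z_p\in S(z)$, $z_2,\ldots,z_{p-1}\in S(z)\setminus\{1\}$, $p\ge2$ (here $u_i,v_i$ range over all elements of $S(z)$, including $1$, with $u_iv_i=z_i$). Finally $M_\star\{z,w\}=f_{\star g}$ with $f=M\{z,w\}$, $g=M^{-1}\{z,0\}$, and $M_\star^{-1}\{z,w\}$ is the inverse of $M_\star\{z,w\}$ in $\mathcal{A}(S)$. *)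

(* Defs.v *)
From HB Require Import structures.
From mathcomp Require Import all_boot all_order all_algebra finmap.
From mathcomp Require Import complex.
From mathcomp Require Import boolp classical_sets functions reals ereal esum.
From mathcomp Require Import -(notations) monalg.

Set Implicit Arguments.
Unset Strict Implicit.
Unset Printing Implicit Defensive.

Import Order.TTheory GRing.Theory Num.Theory.
Local Open Scope ring_scope.

Inductive letter := Lz | Lw.

Definition bool_of_letter a := if a is Lw then true else false.
Definition letter_of_bool (b : bool) := if b then Lw else Lz.
Lemma bool_of_letterK : cancel bool_of_letter letter_of_bool.
Proof. by case. Qed.
HB.instance Definition _ := Countable.copy letter (can_type bool_of_letterK).

Definition word := seq letter.
HB.instance Definition _ := Countable.on word.

Definition zword (s : word) : bool := all (pred1 Lz) s.
Definition zpow n : word := nseq n Lz.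
Definition wpow n : word := nseq n Lw.

(* [blocks s = ([:: (n_1, k_1); ..; (n_{p-1}, k_{p-1})], n_p)] for
   s = z^{n_1} w^{k_1} .. z^{n_{p-1}} w^{k_{p-1}} z^{n_p} with n_1, n_p >= 0
   and all other exponents >= 1; see [blocksK], [blocks_wf], [assembleK]. *)
Fixpoint blocks (s : word) : seq (nat * nat) * nat :=
  match s with
  | [::] => ([::], 0%N)
  | Lz :: s' => match blocks s' with
                | ([::], m) => ([::], m.+1)
                | ((n, k) :: b, m) => ((n.+1, k) :: b, m)
                end
  | Lw :: s' => match blocks s' with
                | ((0%N, k) :: b, m) => ((0%N, k.+1) :: b, m)
                | (b, m) => ((0%N, 1%N) :: b, m)
                end
  end.

Definition assemble (b : seq (nat * nat)) (m : nat) : word :=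
  flatten [seq zpow nk.1 ++ wpow nk.2 | nk <- b] ++ zpow m.

Definition wf_blocks (b : seq (nat * nat)) : bool :=
  all (fun nk => 0 < nk.2)%N b && all (fun nk => 0 < nk.1)%N (behead b).

Lemma blocksK s : assemble (blocks s).1 (blocks s).2 = s.
Proof.
elim: s => [//|a s]; rewrite /assemble /=.
case: a; case: (blocks s) => [[|[n k] b] m] /= e.
- by rewrite e.
- by rewrite -e.
- by rewrite e.
- by case: n e => [|n] /= <-.
Qed.

Lemma blocks_wf s : wf_blocks (blocks s).1.
Proof.
elim: s => [//|[] s]; rewrite /wf_blocks /=;
  case: (blocks s) => [[|[[|n] k] b] m] //=;
  by move=> /andP[/andP[h1 h2] h3]; rewrite ?h1 ?h2 ?h3.
Qed.

Lemma assembleK b m : wf_blocks b -> blocks (assemble b m) = (b, m).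
Proof.
have zp j : blocks (zpow j) = ([::], j) by elim: j => //= j ->.
elim: b => [|[n k] b IH] /=; first by rewrite /assemble /= zp.
rewrite /wf_blocks /= => /andP[/andP[k0 bk] bn].
have bn' : all (fun nk => 0 < nk.1)%N (behead b) by case: (b) bn => //= ? ? /andP[].
have {}IH : blocks (assemble b m) = (b, m).
  by apply: IH; rewrite /wf_blocks bk bn'.
have -> : assemble ((n, k) :: b) m = zpow n ++ wpow k ++ assemble b m.
  by rewrite /assemble /= !catA.
have wk : blocks (wpow k ++ assemble b m) = ((0%N, k) :: b, m).
  case: k k0 => // k _; elim: k => [|k IHk] /=.
    by rewrite IH; case: (b) bn => [|[[|?] ?] ?].
  by move: IHk => /= ->.
by elim: n => [//|n IHn] /=; rewrite IHn.
Qed.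

Definition nfact (s : word) : nat :=
  (\prod_(nk <- (blocks s).1) nk.1`! * (blocks s).2`!)%N.

Section AdmissiblePartitions.
Variable s : word.
Implicit Types (B : {set 'I_(size s)}) (P : {set {set 'I_(size s)}}).

Definition subword B : word := [seq tnth (in_tuple s) i | i <- enum B].

Definition inner (j : 'I_(size s)) B : bool :=
  [&& j \notin B, [exists i in B, i < j]%N & [exists k in B, j < k]%N].

(* A partition is represented by its set of blocks (index sets): ordering the
   blocks by their first index is then a canonical choice, not extra data. *)
Definition admissible P : bool :=
  finset.partition P [set: 'I_(size s)]%SET &&
  [forall B in P, forall j, inner j B ==> (tnth (in_tuple s) j != Lw)].

Definition AP : {set {set {set 'I_(size s)}}} := [set P | admissible P]%SET.
End AdmissiblePartitions.

Definition is_cumulants (C : comPzRingType) (M L : word -> C) : Prop :=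
  forall s, s != [::] ->
    M s = \sum_(P in AP s) \prod_(B in P) L (subword B).

Section CumulantsExist.
Variables (C : comPzRingType) (M : word -> C).

Lemma size_subword (s : word) (B : {set 'I_(size s)}) :
  size (subword B) = #|B|.
Proof. by rewrite size_map cardE. Qed.

Lemma subwordT (s : word) : subword [set: 'I_(size s)]%SET = s.
Proof.
rewrite /subword enum_setT -enumT.
exact: (map_tnth_enum (in_tuple s)).
Qed.

Lemma AP_whole (s : word) : s != [::] -> ([set [set: 'I_(size s)]] \in AP s)%SET.
Proof.
case: s => // a s _; rewrite inE; apply/andP; split.
  apply/and3P; split; first by rewrite /finset.cover finset.big_set1.
    by apply/finset.trivIsetP => A B /set1P-> /set1P->; rewrite eqxx.
  rewrite inE eq_sym -card_gt0 cardsT card_ord //.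
apply/forall_inP => B /set1P->; apply/forallP => j.
by rewrite /inner inE.
Qed.

Lemma AP_card_lt (s : word) (P : {set {set 'I_(size s)}}) (B : {set 'I_(size s)}) :
  P \in AP s -> P != [set [set: 'I_(size s)]]%SET -> B \in P ->
  (size (subword B) < size s)%N.
Proof.
rewrite inE => /andP[/and3P[_ /finset.trivIsetP tP P0] _] PT BP.
rewrite size_subword -[ltnRHS]card_ord -cardsT proper_card // properT.
apply: contraNneq PT => BT; apply/eqP/setP => A; rewrite inE.
apply/idP/eqP => [AP|->]; last by rewrite -BT.
apply/eqP; apply: contraNT P0 => AT.
have := tP _ _ AP BP; rewrite BT => /(_ AT).
by rewrite finset.disjoints_subset finset.setCT finset.subset0 => /eqP <-.
Qed.

Lemma cumulants_sum (L : word -> C) (s : word) : s != [::] ->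
  \sum_(P in AP s) \prod_(B in P) L (subword B) =
  L s + \sum_(P in AP s | P != [set [set: 'I_(size s)]]%SET)
          \prod_(B in P) L (subword B).
Proof.
move=> s0; rewrite (bigD1 _ (AP_whole s0)) /=; congr (_ + _).
by rewrite finset.big_set1 subwordT.
Qed.

Fixpoint cumulant_rec (n : nat) (s : word) : C :=
  if n is n'.+1 then
    M s - \sum_(P in AP s | P != [set [set: 'I_(size s)]]%SET)
            \prod_(B in P) cumulant_rec n' (subword B)
  else 0.

Lemma cumulants_exist : exists L, is_cumulants M L.
Proof.
have rec_irr n : forall s n1 n2, (size s <= n)%N -> (size s < n1)%N ->
    (size s < n2)%N -> cumulant_rec n1 s = cumulant_rec n2 s.
  elim: n => [|n IH] s [|n1] [|n2] //= sn s1 s2; congr (_ - _);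
    apply: eq_bigr => P /andP[PAP PT]; apply: eq_bigr => B BP;
    have Bs := AP_card_lt PAP PT BP.
    by move: (leq_trans Bs sn).
  by apply: IH; [rewrite -ltnS (leq_trans Bs) |
                 apply: leq_trans Bs _ | apply: leq_trans Bs _].
exists (fun s => cumulant_rec (size s).+1 s) => s s0.
rewrite (cumulants_sum (fun s => cumulant_rec (size s).+1 s)) //=.
rewrite -[LHS](subrK (\sum_(P in AP s | P != [set [set: 'I_(size s)]]%SET)
            \prod_(B in P) cumulant_rec (size s) (subword B))).
congr (_ + _); apply: eq_bigr => P /andP[PAP PT]; apply: eq_bigr => B BP.
exact: (rec_irr _ _ _ _ (leqnn _) (AP_card_lt PAP PT BP) (ltnSn _)).
Qed.

Lemma cumulants_unique L1 L2 : is_cumulants M L1 -> is_cumulants M L2 ->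
  forall s, s != [::] -> L1 s = L2 s.
Proof.
move=> h1 h2 s; have [n] := ubnP (size s).
elim: n s => // n IH s sn s0; have := h1 s s0.
rewrite (h2 s s0) !cumulants_sum // => /esym.
rewrite (_ : \sum_(P in AP s | _) \prod_(B in P) L1 _ =
  \sum_(P in AP s | P != [set [set: 'I_(size s)]]%SET)
    \prod_(B in P) L2 (subword B)) => [/addIr //|].
apply: eq_bigr => P /andP[PAP PT]; apply: eq_bigr => B BP; apply: IH.
  exact: leq_trans (AP_card_lt PAP PT BP) _.
rewrite -size_eq0 size_subword cards_eq0.
by apply: contraTneq BP => ->; move: PAP; rewrite inE => /andP[/and3P[]].
Qed.

End CumulantsExist.

Inductive gen := GX | GX' | GP.

Definition opt_of_gen a :=
  match a with GX => Some false | GX' => Some true | GP => None end.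
Definition gen_of_opt o :=
  match o with Some false => GX | Some true => GX' | None => GP end.
Lemma opt_of_genK : cancel opt_of_gen gen_of_opt. Proof. by case. Qed.
HB.instance Definition _ := Countable.copy gen (can_type opt_of_genK).

(* Monomials in X, X', P modulo P^2 = P: words without two consecutive P's,
   multiplied by concatenating and then collapsing PP to P. The algebra
   C<X, X', P> is the monoid algebra of this monoid. *)
Definition noPP : rel gen := fun a b => ~~ ((a == GP) && (b == GP)).

Definition pcons (a : gen) (t : seq gen) : seq gen :=
  if (a == GP) && (ohead t == Some GP) then t else a :: t.
Definition collapse (t : seq gen) : seq gen := foldr pcons [::] t.

Lemma pconsE a t : sorted noPP (a :: t) -> pcons a t = a :: t.
Proof. by case: t => [|b t]; rewrite /pcons ?andbF //= => /andP[/negbTE->]. Qed.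

Lemma collapse_sorted t : sorted noPP (collapse t).
Proof.
elim: t => //= a t; rewrite /pcons; case: ifPn => // h.
case: (collapse t) h => //= b u h ->; rewrite andbT.
by move: h; rewrite /noPP.
Qed.

Lemma collapse_id t : sorted noPP t -> collapse t = t.
Proof.
elim: t => //= a t IH st.
by rewrite IH; [exact: pconsE | exact: path_sorted st].
Qed.

Lemma pconsPP t : pcons GP (pcons GP t) = pcons GP t.
Proof. by rewrite {2 3}/pcons eqxx /=; case: ifP => h; rewrite /pcons ?h. Qed.

Lemma collapse_catr t u : collapse (t ++ collapse u) = collapse (t ++ u).
Proof. by rewrite /collapse !foldr_cat -!/(collapse _) collapse_id // collapse_sorted. Qed.

Lemma collapse_catl t u : collapse (collapse t ++ u) = collapse (t ++ u).
Proof.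
elim: t => //= a t IH; rewrite {1}/pcons; case: ifP => [/andP[/eqP-> h]|_] /=.
  rewrite -IH; case: (collapse t) h => // b v /eqP[->] /=.
  by rewrite pconsPP.
by rewrite IH.
Qed.

Record bmonom := BMonom { bseq :> seq gen ; bseqP : sorted noPP bseq }.
HB.instance Definition _ := [isSub for bseq].
HB.instance Definition _ := [Countable of bmonom by <:].

Definition bone : bmonom := @BMonom [::] isT.
Definition bmul (u v : bmonom) : bmonom := BMonom (collapse_sorted (u ++ v)).

Lemma bmulA : associative bmul.
Proof.
by move=> u v t; apply: val_inj; rewrite /= collapse_catr collapse_catl catA.
Qed.
Lemma bmul1m : left_id bone bmul.
Proof. by move=> u; apply: val_inj; rewrite /= collapse_id // bseqP. Qed.
Lemma bmulm1 : right_id bone bmul.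
Proof. by move=> u; apply: val_inj; rewrite /= cats0 collapse_id // bseqP. Qed.
Lemma bunitm u v : bmul u v = bone -> u = bone /\ v = bone.
Proof.
move=> /(congr1 val) /= h.
have n0 t : collapse t = [::] -> t = [::].
  by case: t => // a t /=; rewrite /pcons; case: ifP => // /andP[_]; case: (collapse t).
by move/n0: h; case: u v => [[|//] ?] [[|//] ?] _; split; apply: val_inj.
Qed.
HB.instance Definition _ :=
  Choice_isMonomialDef.Build bmonom bmulA bmul1m bmulm1 bunitm.

Definition bone_gen (a : gen) : bmonom := @BMonom [:: a] isT.

Lemma brev_subproof (u : bmonom) : sorted noPP (rev u).
Proof.
rewrite rev_sorted; case: u => /= u; apply: sub_sorted => a b.
by rewrite /noPP andbC.
Qed.
Definition brev (u : bmonom) : bmonom := BMonom (brev_subproof u).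

Definition Balg (R : rcfType) := malg bmonom R[i].
HB.instance Definition _ (R : rcfType) := GRing.Lalgebra.on (Balg R).

Section StarAlgebra.
Variable R : rcfType.
Implicit Types a b : Balg R.

Definition bgen (g : gen) : Balg R := mkmalgU (bone_gen g) 1.

Definition star a : Balg R :=
  \sum_(u <- msupp a) mkmalgU (brev u) (mcoeff u a)^*.

Lemma brevK : involutive brev.
Proof. by move=> u; apply: val_inj; rewrite /= revK. Qed.

Lemma mcoeff_star u a : mcoeff u (star a) = (mcoeff (brev u) a)^*.
Proof.
rewrite /star raddf_sum /=.
under eq_bigr => v _ do rewrite mcoeffU.
have E v : (brev v == u) = (v == brev u) by rewrite (can2_eq brevK brevK).
under eq_bigr => v _ do rewrite E.
have [h|h] := boolP (brev u \in msupp a).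
  rewrite (big_fsetD1 (brev u)) //= eqxx big1_fset ?addr0 // => v.
  by rewrite in_fsetD1 => /andP[/negbTE->].
rewrite big1_fset => [|v vs _]; first by rewrite mcoeff_outdom // conjC0.
by case: eqP => // e; rewrite -e vs in h.
Qed.

Lemma starK : involutive star.
Proof. by move=> a; apply/malgP => u; rewrite !mcoeff_star brevK conjCK. Qed.

Lemma starD : {morph star : a b / a + b}.
Proof. by move=> a b; apply/malgP => u; rewrite !(mcoeff_star, mcoeffD) rmorphD. Qed.

Lemma starU u c : star (mkmalgU u c) = mkmalgU (brev u) c^*.
Proof.
apply/malgP => v; rewrite mcoeff_star !mcoeffU.
by rewrite -(inj_eq (can_inj brevK)) brevK rmorphMn.
Qed.

Lemma rev_collapse t : rev (collapse t) = collapse (rev t).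
Proof.
elim: t => //= a t IH; rewrite rev_cons -cats1 -collapse_catl -IH cats1 -rev_cons.
have := collapse_sorted t; case: (collapse t) => [|b c] st.
  by rewrite /= /pcons /= andbF.
rewrite {1}/pcons; case: ifP => [/andP[/eqP-> /eqP[eb]]|h].
  rewrite eb (rev_cons GP (GP :: c)) -cats1 rev_cons -cats1 -catA.
  rewrite -collapse_catr /= cats1 -rev_cons -eb collapse_id //.
  exact: (brev_subproof (@BMonom (b :: c) st)).
rewrite collapse_id //; apply: (brev_subproof (@BMonom (a :: b :: c) _)).
by rewrite /= in st *; rewrite st andbT /noPP; move: h => /= /negbT.
Qed.

Lemma brevM u v : brev (bmul u v) = bmul (brev v) (brev u).
Proof. by apply: val_inj; rewrite /= rev_collapse rev_cat. Qed.

Lemma star0 : star 0 = 0.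
Proof. by apply/malgP => u; rewrite mcoeff_star !mcoeff0 conjC0. Qed.

Lemma starM a b : star (a * b) = star b * star a.
Proof.
have sS := big_morph star starD star0.
rewrite malgME sS [RHS]mulr_suml.
under eq_bigr => k1 _ do rewrite sS.
under [RHS]eq_bigr => k1 _ do rewrite mulr_sumr.
rewrite exchange_big /=; apply: eq_bigr => k1 _; apply: eq_bigr => k2 _.
by rewrite starU malgM_def fgmulUU rmorphM mulrC brevM.
Qed.

Lemma starZ c a : star (c *: a) = c^* *: star a.
Proof. by apply/malgP => u; rewrite !(mcoeff_star, mcoeffZ) rmorphM. Qed.

Lemma star_bgen g : star (bgen g) = bgen g.
Proof. by rewrite starU conjC1; congr mkmalgU; apply: val_inj. Qed.

Lemma bgenPP : bgen GP * bgen GP = bgen GP.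
Proof.
by rewrite malgM_def fgmulUU mulr1; congr mkmalgU; apply: val_inj.
Qed.

End StarAlgebra.

Definition is_state (R : rcfType) (phi : {scalar Balg R}) : Prop :=
  phi 1 = 1 /\ forall a, 0 <= phi (star a * a).

Definition moment (R : rcfType) (phi : {scalar Balg R}) (s : word) : R[i] :=
  phi (\prod_(a <- s) bgen R (match a with Lz => GX | Lw => GX' end)).

Definition wseries (C : Type) := word -> C.

Section SemigroupAlgebra.
Variable C : fieldType.
Local Notation A := (wseries C).
Implicit Types f g h : A.

HB.instance Definition _ := GRing.Zmodule.copy A (word -> C).

Definition wconv f g : A := fun s =>
  \sum_(i < (size s).+1) f (take i s) * g (drop i s).
Definition wone : A := fun s => (s == [::])%:R.

Let wder a f : A := fun s => f (a :: s).

Lemma wconv0 f g : wconv f g [::] = f [::] * g [::].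
Proof. by rewrite /wconv big_ord_recl big_ord0 addr0. Qed.

Lemma wconvS f g a s :
  wconv f g (a :: s) = f [::] * g (a :: s) + wconv (fun t => f (a :: t)) g s.
Proof. by rewrite /wconv big_ord_recl. Qed.

Lemma wconvDl : left_distributive wconv +%R.
Proof.
move=> f g h; apply/funext => s.
rewrite -[RHS]/(wconv f h s + wconv g h s) /wconv -big_split /=.
by apply: eq_bigr => i _; rewrite -mulrDl.
Qed.

Lemma wconvDr : right_distributive wconv +%R.
Proof.
move=> f g h; apply/funext => s.
rewrite -[RHS]/(wconv f g s + wconv f h s) /wconv -big_split /=.
by apply: eq_bigr => i _; rewrite -mulrDr.
Qed.

Lemma wconvA : associative wconv.
Proof.
move=> f g h; apply/funext => s; elim: s f g => [|a s IH] f g.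
  by rewrite !wconv0 mulrA.
rewrite !wconvS wconv0 IH mulrDr mulrA -addrA; congr (_ + _).
have -> : (fun t => wconv f g (a :: t)) =
    (fun t => f [::] * wder a g t) + wconv (wder a f) g :> A.
  by apply/funext => t; rewrite wconvS.
rewrite wconvDl -[RHS]/(wconv _ h s + wconv _ h s); congr (_ + _).
by rewrite /wconv mulr_sumr; apply: eq_bigr => i _; rewrite mulrA.
Qed.

Lemma wconv1l : left_id wone wconv.
Proof.
move=> f; apply/funext => -[|a s]; first by rewrite wconv0 /wone mul1r.
by rewrite wconvS mul1r [X in _ + X]big1 ?addr0 // => i _; rewrite mul0r.
Qed.

Lemma wconv1r : right_id wone wconv.
Proof.
move=> f; apply/funext => s; elim: s f => [|a s IH] f.
  by rewrite wconv0 /wone mulr1.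
by rewrite wconvS IH mulr0 add0r.
Qed.

Lemma wone_neq0 : wone != 0.
Proof. by apply/eqP => /(congr1 (@^~ [::])) /eqP; rewrite oner_eq0. Qed.

HB.instance Definition _ := GRing.Zmodule_isNzRing.Build A
  wconvA wconv1l wconv1r wconvDl wconvDr wone_neq0.

Lemma wmulE f g s :
  (f * g) s = \sum_(i < (size s).+1) f (take i s) * g (drop i s).
Proof. by []. Qed.
Lemma woneE s : (1 : A) s = (s == [::])%:R. Proof. by []. Qed.

(* Right inverse, by recursion on the length (the first argument bounds it). *)
Fixpoint wrinv_rec (n : nat) f (s : word) : C :=
  if n is n'.+1 then
    ((s == [::])%:R
      - \sum_(i < size s) f (take i.+1 s) * wrinv_rec n' f (drop i.+1 s))
    / f [::]
  else 0.
Definition wrinv f : A := fun s => wrinv_rec (size s).+1 f s.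

Lemma wrinv_recE n f s : (size s < n)%N -> wrinv_rec n f s = wrinv f s.
Proof.
suff H m : forall t n1 n2, (size t <= m)%N -> (size t < n1)%N ->
    (size t < n2)%N -> wrinv_rec n1 f t = wrinv_rec n2 f t.
  by move=> h; apply: (H (size s)).
elim: m => [|m IH] t [|n1] [|n2] //= tm t1 t2; congr ((_ - _) / _);
  apply: eq_bigr => i _; first by case: t tm {t1 t2} i => // _ [].
have it : (size (drop i.+1 t) < size t)%N by rewrite size_drop; case: (t) i => [[]//|? ? i /=]; rewrite subSS ltnS leq_subr.
by congr (_ * _); apply: IH;
  [rewrite -ltnS (leq_trans it) | apply: leq_trans it _ | apply: leq_trans it _].
Qed.

Lemma wrinvP f : f [::] != 0 -> f * wrinv f = 1.
Proof.
move=> f0; apply/funext => s; rewrite wmulE woneE big_ord_recl take0 drop0.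
rewrite {1}/wrinv /= [f _ * _]mulrC divfK //.
suff -> : \sum_(i < size s)
      f (take i.+1 s) * wrinv_rec (size s) f (drop i.+1 s) =
    \sum_(i < size s) f (take (bump 0 i) s) * wrinv f (drop (bump 0 i) s).
  by rewrite subrK.
apply: eq_bigr => i _; congr (_ * _); rewrite wrinv_recE //.
by rewrite size_drop; case: (s) i => [[]//|? ? i /=]; rewrite subSS ltnS leq_subr.
Qed.

Lemma wrinv_linv f : f [::] != 0 -> wrinv f * f = 1.
Proof.
move=> f0; have ff' := wrinvP f0.
have g0 : wrinv f [::] != 0.
  apply/eqP => g0; have := congr1 (@^~ [::]) ff'.
  rewrite wmulE big_ord_recl big_ord0 /= g0 mulr0 addr0 => /esym/eqP.
  by rewrite oner_eq0.
have e : f = wrinv (wrinv f).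
  by rewrite -[LHS]mulr1 -(wrinvP g0) mulrA ff' mul1r.
by rewrite [X in _ * X]e wrinvP.
Qed.

Definition wunit : pred A := fun f => f [::] != 0.
Definition winv f : A := if wunit f then wrinv f else f.

Lemma wmulVr : {in wunit, left_inverse 1 winv *%R}.
Proof. by move=> f uf; rewrite /winv ifT // wrinv_linv. Qed.
Lemma wdivrr : {in wunit, right_inverse 1 winv *%R}.
Proof. by move=> f uf; rewrite /winv ifT // wrinvP. Qed.
Lemma wunitP f g : g * f = 1 /\ f * g = 1 -> wunit f.
Proof.
case=> _ fg; apply/eqP => f0; have := congr1 (@^~ [::]) fg.
rewrite wmulE big_ord_recl big_ord0 /= f0 mul0r addr0 => /esym/eqP.
by rewrite oner_eq0.
Qed.
Lemma winv_out : {in [predC wunit], winv =1 id}.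
Proof. by move=> f /= uf; rewrite /winv ifN. Qed.

HB.instance Definition _ := GRing.NzRing_hasMulInverse.Build A
  wmulVr wdivrr wunitP winv_out.

Lemma wunitE f : (f \is a GRing.unit) = (f [::] != 0). Proof. by []. Qed.

(* A(S(z)) is identified with the unital
   subalgebra of A(S) of the functions supported in S(z); this subalgebra is
   closed under inverses (see [zpartV]), so inverses may be taken in A(S). *)
Definition zpart f : A := fun s => if zword s then f s else 0.

Lemma zpartMl f g : zpart f = f -> f * zpart g = zpart (f * g).
Proof.
move=> fz; apply/funext => s; rewrite /zpart !wmulE.
have catz i : zword s = zword (take i s) && zword (drop i s).
  by rewrite /zword -all_cat cat_take_drop.
case: ifPn => zs.
  by apply: eq_bigr => i _; move: zs; rewrite (catz i) => /andP[_ ->].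
rewrite big1 // => i _; move: zs; rewrite (catz i) negb_and.
by case/orP => /negbTE zi; [rewrite -fz /zpart zi mul0r | rewrite zi mulr0].
Qed.

Lemma zpartV f : zpart f = f -> zpart f^-1 = f^-1.
Proof.
move=> fz; have [uf|uf] := boolP (f \is a GRing.unit); last by rewrite invr_out.
have zpart1 : zpart 1 = 1.
  by apply/funext => -[|a s] //; rewrite /zpart woneE; case: ifP.
by apply: (mulrI uf); rewrite zpartMl // divrr.
Qed.

(* The blocks still to be read are [b], with last exponent [m]; [pre] is the
   word u_1 w_1 .. u_i w_i obtained from those already read. Each block
   z^n w^k contributes the sum over the factorizations z^n = z^a z^(n - a). *)
Fixpoint fstar_rec f g (pre : word) (b : seq (nat * nat)) (m : nat) : C :=
  match b with
  | [::] => f (pre ++ zpow m)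
  | (n, k) :: b' =>
      \sum_(a < n.+1)
        fstar_rec f g (pre ++ zpow a ++ wpow k) b' m * g (zpow (n - a))
  end.
Definition fstar f g : A :=
  fun s => fstar_rec f g [::] (blocks s).1 (blocks s).2.

Lemma fstar_zword f g n : fstar f g (zpow n) = f (zpow n).
Proof. by rewrite /fstar (@assembleK [::] n). Qed.

End SemigroupAlgebra.

Definition Mgf (C : fieldType) (M : word -> C) : wseries C :=
  fun s => M s / (nfact s)%:R.
Definition Lgf (C : fieldType) (L : word -> C) : wseries C :=
  fun s => if s == [::] then 0 else L s / (nfact s)%:R.

Definition Mstar (C : fieldType) (M : word -> C) : wseries C :=
  fstar (Mgf M) (zpart (Mgf M))^-1.

Section WeightedNorm.
Variable R : realType.
Implicit Types (W : word -> R) (f : wseries R[i]).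

Definition is_weight W : Prop :=
  (forall s, 0 < W s) /\ forall s t, W (s ++ t) <= W s * W t.

Definition wnorm (D : set word) W f : \bar R :=
  (\esum_(s in D) (W s * ComplexField.Normc.normc (f s))%:E)%E.

Definition l1 (D : set word) W f : Prop := (wnorm D W f < +oo)%E.

Definition Sz : set word := [set s | zword s].

Definition wtilde W (Q : R) : word -> R :=
  fun s => W s * Q ^- (count_mem Lw s).

End WeightedNorm.

(* Main.v *)
Require Import Defs.
From HB Require Import structures.
From mathcomp Require Import all_boot all_order all_algebra finmap.
From mathcomp Require Import complex.
From mathcomp Require Import boolp classical_sets functions cardinality fsbigop.
From mathcomp Require Import reals ereal esum.
From mathcomp Require Import ring lra.

Set Implicit Arguments.
Unset Strict Implicit.
Unset Printing Implicit Defensive.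

Import Order.TTheory GRing.Theory Num.Theory.
Local Open Scope ring_scope.

(* A block of an admissible partition contains consecutive letters w, and a
   block without w lies between two consecutive letters w. Decomposing the
   partitions along the block of the first w therefore gives recursions in which
   the z's in each gap between w's are distributed freely; after division by
   n(s)! these are Cauchy products with the sequence M(z^n)/n!. The operation
   f |-> f_{*g} with g the inverse of M{z,0} cancels these factors in all gaps but
   the last, which leaves M_* = M{z,0} + (L - L{z,0}) M_*.
   For the norms, put c = ||M{z,w}||_W - 1 < 1 - 1/Q. The inverse g has
   norm at most 1/(1-c) <= Q, which the factor Q^{-1} per letter w absorbs (each
   letter w introduces at most one factor g, and W is invariant under cyclic
   shifts), so the norm of M_* for the weight W~ is at most 1 + c < 2 and M_* is
   invertible in l^1(S,W~). *)

(** * Sums over set partitions of a sequence *)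

(** Subsequences are chosen by position, so equal entries give repeated pairs; the repetitions
    become the binomials of [sum_splits_nseq]. *)
Fixpoint splits (T : Type) (l : seq T) : seq (seq T * seq T) :=
  if l is x :: l' then
    [seq (x :: p.1, p.2) | p <- splits l'] ++ [seq (p.1, x :: p.2) | p <- splits l']
  else [:: ([::], [::])].

Lemma size_splits (T : eqType) (l : seq T) p :
  p \in splits l -> (size p.1 + size p.2)%N = size l.
Proof.
elim: l p => [|x l IH] p /=; first by rewrite inE => /eqP->.
by rewrite mem_cat => /orP[] /mapP[q /IH <- ->] //=; rewrite addnS.
Qed.

Lemma mem_splits (T : eqType) (l : seq T) p : p \in splits l ->
  {subset p.1 <= l} /\ {subset p.2 <= l}.
Proof.
elim: l p => [|x l IH] p /=; first by rewrite inE => /eqP->.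
by rewrite mem_cat => /orP[] /mapP[q /IH [h1 h2] ->] /=; split=> y;
  rewrite !inE; do ?[case/orP=> [->//|]]; move=> yq; rewrite ?(h1 _ yq) ?(h2 _ yq) orbT.
Qed.

Lemma splits_map (T T' : Type) (h : T -> T') l :
  splits (map h l) = [seq (map h p.1, map h p.2) | p <- splits l].
Proof. by elim: l => //= x l ->; rewrite map_cat -!map_comp. Qed.

Section SumSplits.
Variables (T : Type) (V : nmodType).
Implicit Types (l : seq T) (F : seq T -> seq T -> V).

Lemma sum_splits_nil F : \sum_(p <- splits [::]) F p.1 p.2 = F [::] [::].
Proof. by rewrite big_seq1. Qed.

Lemma sum_splits_cons x l F : \sum_(p <- splits (x :: l)) F p.1 p.2 =
  \sum_(p <- splits l) F (x :: p.1) p.2 + \sum_(p <- splits l) F p.1 (x :: p.2).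
Proof. by rewrite big_cat !big_map. Qed.

Lemma sum_splits_cat l1 l2 F : \sum_(p <- splits (l1 ++ l2)) F p.1 p.2 =
  \sum_(p <- splits l1) \sum_(q <- splits l2) F (p.1 ++ q.1) (p.2 ++ q.2).
Proof.
elim: l1 F => [|x l1 IH] F; first by rewrite big_seq1.
rewrite sum_splits_cons (IH (fun a b => F (x :: a) b)) (IH (fun a b => F a (x :: b))).
by rewrite -(sum_splits_cons x l1
  (fun a b => \sum_(q <- splits l2) F (a ++ q.1) (b ++ q.2))).
Qed.

(** Both sides distribute the entries of [l] over three subsequences; the order in which the first
    two are picked is immaterial. *)
Lemma sum_splits_swap l (F : seq T -> seq T -> seq T -> V) :
  \sum_(p <- splits l) \sum_(q <- splits p.2) F p.1 q.1 q.2 =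
  \sum_(p <- splits l) \sum_(q <- splits p.2) F q.1 p.1 q.2.
Proof.
elim: l F => [|x l IH] F; first by rewrite !big_seq1.
rewrite (sum_splits_cons x l (fun b r => \sum_(q <- splits r) F b q.1 q.2)).
rewrite (sum_splits_cons x l (fun b r => \sum_(q <- splits r) F q.1 b q.2)).
under [X in _ + X]eq_bigr => p _ do
  rewrite (sum_splits_cons x p.2 (fun c d => F p.1 c d)).
under [X in _ = _ + X]eq_bigr => p _ do
  rewrite (sum_splits_cons x p.2 (fun c d => F c p.1 d)).
rewrite !big_split /= (IH (fun a b c => F (x :: a) b c)).
by rewrite (IH (fun a b c => F a (x :: b) c)) (IH (fun a b c => F a b (x :: c))) addrCA.
Qed.

Lemma sum_splits_nseq n (x : T) F :
  \sum_(p <- splits (nseq n x)) F p.1 p.2 =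
  \sum_(k < n.+1) F (nseq k x) (nseq (n - k) x) *+ 'C(n, k).
Proof.
elim: n F => [|n IH] F; first by rewrite sum_splits_nil big_ord1 bin0.
rewrite sum_splits_cons (IH (fun a b => F (x :: a) b)) (IH (fun a b => F a (x :: b))).
rewrite [in RHS]big_ord_recl /= bin0 ?subn0 mulr1n.
under [in RHS]eq_bigr => i _ do rewrite /bump /= add1n binS mulrnDr subSS.
rewrite big_split /= [RHS]addrA [RHS]addrC; congr (_ + _).
rewrite [in LHS]big_ord_recl [in RHS]big_ord_recr /= (@bin_small n n.+1) // mulr0n addr0.
rewrite !bin0 subn0; congr (_ + _); apply: eq_bigr => i _.
by rewrite /bump /= add1n add0n -[(n - i)%N](subnSK (ltn_ord i)).
Qed.
End SumSplits.

Lemma sum_splits_only_nil (T : eqType) (V : nmodType) (l : seq T)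
    (F : seq T -> seq T -> V) :
  (forall p, p \in splits l -> p.1 != [::] -> F p.1 p.2 = 0) ->
  \sum_(p <- splits l) F p.1 p.2 = F [::] l.
Proof.
elim: l F => [|x l IH] F F0; first by rewrite big_seq1.
rewrite sum_splits_cons big_seq big1 ?add0r => [|p pl].
  rewrite (IH (fun a b => F a (x :: b))) // => p pl.
  by apply: (F0 (p.1, x :: p.2)); rewrite /= mem_cat; apply/orP; right; apply/mapP; exists p.
by apply: (F0 (x :: p.1, p.2)) => //; rewrite /= mem_cat; apply/orP; left; apply/mapP; exists p.
Qed.

(* Sum over the set partitions of the entries of [l] of the products of the
   weights [phi] of the blocks, by recursion on the block of the first entry;
   the natural number bounds the length of [l]. *)
Fixpoint zrec (T : Type) (C : pzRingType) (phi : seq T -> C) (n : nat) (l : seq T) : C :=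
  if n is n'.+1 then
    if l is x :: l' then \sum_(p <- splits l') phi (x :: p.1) * zrec phi n' p.2
    else 1
  else 1.
Definition zsum (T : Type) (C : pzRingType) (phi : seq T -> C) l := zrec phi (size l) l.

Lemma zrecE (T : eqType) (C : pzRingType) (phi : seq T -> C) n l :
  (size l <= n)%N -> zrec phi n l = zsum phi l.
Proof.
suff H m : forall t n1 n2, (size t <= m)%N -> (size t <= n1)%N ->
    (size t <= n2)%N -> zrec phi n1 t = zrec phi n2 t.
  by move=> h; apply: (H (size l)).
elim: m => [|m IH] [|x t] [|n1] [|n2] //= tm t1 t2.
rewrite big_seq [RHS]big_seq; apply: eq_bigr => p /size_splits sp; congr (_ * _).
have pt : (size p.2 <= size t)%N by rewrite -sp leq_addl.
by apply: IH; apply: leq_trans pt _.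
Qed.

Section PartitionSum.
Variables (T : eqType) (C : comPzRingType).
Implicit Types (phi : seq T -> C) (l : seq T).

Lemma zsum_nil phi : zsum phi [::] = 1. Proof. by []. Qed.

Lemma zsum_cons phi x l :
  zsum phi (x :: l) = \sum_(p <- splits l) phi (x :: p.1) * zsum phi p.2.
Proof.
rewrite /zsum /= big_seq [RHS]big_seq; apply: eq_bigr => p /size_splits sp.
by rewrite zrecE // -sp leq_addl.
Qed.

(** A set partition can be decomposed along the block of any entry [x], not only the first.
    Induction: take out the block of the first entry [y], then that of [x] from what remains. *)
Lemma zsum_pivot phi l1 x l2 : zsum phi (l1 ++ x :: l2) =
  \sum_(p <- splits l1) \sum_(q <- splits l2)
    phi (p.1 ++ x :: q.1) * zsum phi (p.2 ++ q.2).
Proof.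
have [n] := ubnP (size l1 + size l2); elim: n l1 l2 => // n IH [|y l1] l2 sz.
  by rewrite /= big_seq1 zsum_cons.
rewrite cat_cons zsum_cons (sum_splits_cat l1 (x :: l2)
  (fun b r => phi (y :: b) * zsum phi r)).
rewrite (sum_splits_cons y l1
  (fun a b => \sum_(q <- splits l2) phi (a ++ x :: q.1) * zsum phi (b ++ q.2))).
under eq_bigr => p _ do rewrite (sum_splits_cons x l2
  (fun a b => phi (y :: p.1 ++ a) * zsum phi (p.2 ++ b))).
(* The terms where [y] and [x] share a block agree already; in the others the two blocks have to be
   extracted in the opposite order, by [sum_splits_swap]. *)
rewrite big_split /=; congr (_ + _).
transitivity (\sum_(p <- splits l1) \sum_(q <- splits l2)
   \sum_(p' <- splits p.2) \sum_(q' <- splits q.2)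
     phi (y :: p.1 ++ q.1) * (phi (p'.1 ++ x :: q'.1) * zsum phi (p'.2 ++ q'.2))).
  rewrite big_seq [RHS]big_seq; apply: eq_bigr => p /size_splits sp.
  rewrite big_seq [RHS]big_seq; apply: eq_bigr => q /size_splits sq.
  rewrite IH; last first.
    move: sz; rewrite ltnS /= addSn; apply: leq_trans.
    by rewrite ltnS -sp -sq leq_add // leq_addl.
  by rewrite mulr_sumr; apply: eq_bigr => p' _; rewrite mulr_sumr.
transitivity (\sum_(p <- splits l1) \sum_(q <- splits l2)
   \sum_(p' <- splits p.2) \sum_(q' <- splits q.2)
     phi (p.1 ++ x :: q.1) * (phi (y :: p'.1 ++ q'.1) * zsum phi (p'.2 ++ q'.2))); last first.
  apply: eq_bigr => p _; apply: eq_bigr => q _.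
  rewrite zsum_cons mulr_sumr (sum_splits_cat p.2 q.2
    (fun a b => phi (p.1 ++ x :: q.1) * (phi (y :: a) * zsum phi b))).
  by [].
under eq_bigr => p _ do rewrite exchange_big /=.
under [RHS]eq_bigr => p _ do rewrite exchange_big /=.
rewrite (sum_splits_swap l1 (fun a b c => \sum_(q <- splits l2)
   \sum_(q' <- splits q.2) phi (y :: a ++ q.1) * (phi (b ++ x :: q'.1) * zsum phi (c ++ q'.2)))).
apply: eq_bigr => p _; apply: eq_bigr => p' _.
rewrite (sum_splits_swap l2 (fun a b c => phi (y :: p'.1 ++ a) * (phi (p.1 ++ x :: b) * zsum phi (p'.2 ++ c)))).
by apply: eq_bigr => q _; apply: eq_bigr => q' _; rewrite mulrCA.
Qed.

(** No block of nonzero weight meets both parts, so the surviving partitions are pairs of a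
    partition of [l1] and one of [l2]. *)
Lemma zsum_cat phi l1 l2 :
  (forall b1 b2 : seq T, {subset b1 <= l1} -> {subset b2 <= l2} ->
     b1 != [::] -> b2 != [::] -> phi (b1 ++ b2) = 0) ->
  zsum phi (l1 ++ l2) = zsum phi l1 * zsum phi l2.
Proof.
have [n] := ubnP (size l1); elim: n l1 => // n IH [|x l1] sz h.
  by rewrite zsum_nil mul1r.
rewrite cat_cons !zsum_cons mulr_suml.
rewrite (sum_splits_cat l1 l2 (fun a b => phi (x :: a) * zsum phi b)).
rewrite big_seq [RHS]big_seq; apply: eq_bigr => p ps.
have [ps1 ps2] := mem_splits ps.
rewrite (sum_splits_only_nil
  (F := fun a b => phi (x :: p.1 ++ a) * zsum phi (p.2 ++ b))); last first.
  move=> q /mem_splits[qs1 qs2] q0; rewrite -cat_cons h ?mul0r // => y.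
  by rewrite !inE => /orP[->//|/ps1->]; rewrite orbT.
rewrite cats0 -mulrA IH // => [|b1 b2 h1 h2].
  by move: sz; rewrite ltnS; apply: leq_trans; rewrite /= ltnS -(size_splits ps) leq_addl.
by apply: h => // y /h1 /ps2 yl; rewrite inE yl orbT.
Qed.
End PartitionSum.

Lemma zsum_map (T T' : eqType) (C : comPzRingType) (phi : seq T' -> C) (h : T -> T') l :
  zsum phi (map h l) = zsum (phi \o map h) l.
Proof.
have [n] := ubnP (size l); elim: n l => // n IH [|x l] //= sz.
rewrite !zsum_cons splits_map big_map big_seq [RHS]big_seq.
apply: eq_bigr => p /size_splits sp; rewrite /= IH //.
by move: sz; rewrite ltnS; apply: leq_trans; rewrite /= ltnS -sp leq_addl.
Qed.

(** * From set partitions of a finite type to partition sums over lists *)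

(** Partitions are grouped by their block [B] at [x]; deleting [B] is a bijection onto the
    partitions of [D :\: B]. *)
Lemma sum_partition_pivot (T : finType) (C : comPzRingType) (psi : {set T} -> C)
    (D : {set T}) (x : T) : x \in D ->
  \sum_(P : {set {set T}} | finset.partition P D) \prod_(B in P) psi B =
  \sum_(B : {set T} | (B \subset D) && (x \in B)) psi B *
    \sum_(P : {set {set T}} | finset.partition P (D :\: B)%SET) \prod_(A in P) psi A.
Proof.
move=> xD.
rewrite (partition_big (fun P : {set {set T}} => finset.pblock P x)
    (fun B => (B \subset D) && (x \in B))) /=; last first.
  move=> P PD; have xP : x \in finset.cover P by rewrite (finset.cover_partition PD).
  by rewrite finset.mem_pblock xP andbT (finset.partitionS PD) // finset.pblock_mem.
apply: eq_bigr => B /andP[BD xB]; rewrite mulr_sumr.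
rewrite (reindex_onto (fun P => B |: P)%SET (fun P => P :\ B)%SET) /=; last first.
  move=> P /andP[PD /eqP <-]; apply: finset.setD1K.
  by rewrite finset.pblock_mem // (finset.cover_partition PD).
have B0 : B != finset.set0 by apply: contraTneq xB => ->; rewrite inE.
have dB (P : {set {set T}}) : finset.partition P (D :\: B)%SET -> B \notin P.
  move=> PD; apply: contraL xB => /(finset.partitionS PD)/fintype.subsetP BDB.
  by apply/negP => xB; have := BDB _ xB; rewrite inE xB.
apply: eq_big => [P|P].
  apply/idP/idP => [/andP[/andP[PD _] /eqP <-]|PD].
    by apply: finset.partitionD1 PD _; rewrite finset.setU11.
  have PD' : finset.partition (B |: P)%SET D.
    rewrite -(finset.setID D B) (finset.setIidPr BD); apply: finset.partitionU1 PD B0 _.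
    by rewrite finset.disjoints_subset finset.setDE finset.setCI finset.setCK finset.subsetUr.
  rewrite PD' /= (@finset.def_pblock _ _ B) ?eqxx ?finset.setU11 //=; last exact: finset.partition_trivIset PD'.
  by rewrite finset.setU1K ?dB.
case/andP=> /andP[PD _] /eqP PB; rewrite finset.big_setU1 //=.
by rewrite -PB !inE eqxx.
Qed.

(** Since [l] has no repeated entries, choosing positions in [l] is the same as choosing a subset of
    its entries. *)
Lemma sum_subsets (T : finType) (V : nmodType) (l : seq T) (F : seq T -> seq T -> V) :
  uniq l ->
  \sum_(B : {set T} | B \subset [set y in l]%SET)
    F [seq y <- l | y \in B] [seq y <- l | y \notin B] =
  \sum_(p <- splits l) F p.1 p.2.
Proof.
elim: l F => [|x l IH] F /=.
  move=> _; rewrite big_seq1 (big_pred1 finset.set0) // => B.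
  rewrite /= -finset.subset0 (_ : [set y in [::]]%SET = finset.set0 :> {set T}) //.
case/andP=> xl ul.
rewrite (sum_splits_cons x l F) -(IH (fun a b => F (x :: a) b)) // -(IH (fun a b => F a (x :: b))) //.
rewrite (bigID (fun B : {set T} => x \in B)) /=; congr (_ + _); last first.
  apply: eq_big => [B|B /andP[_ /negbTE->] //].
  apply/andP/idP => [[/fintype.subsetP Bl xB]|/fintype.subsetP Bl].
    apply/fintype.subsetP => y yB; have := Bl _ yB; rewrite !inE => /orP[/eqP yx|//].
    by rewrite -yx yB in xB.
  split; last by apply/negP => /Bl; rewrite inE (negbTE xl).
  by apply/fintype.subsetP => y /Bl; rewrite !inE => ->; rewrite orbT.
rewrite (reindex_onto (fun B => x |: B)%SET (fun B => B :\ x)%SET) /=; last first.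
  by move=> B /andP[_ xB]; apply: finset.setD1K.
apply: eq_big => [B|B].
  rewrite finset.setU11 andbT; apply/andP/idP => [[/fintype.subsetP Bl /eqP Bx]|/fintype.subsetP Bl].
    apply/fintype.subsetP => y; rewrite -Bx !inE => /andP[/negbTE yx yB].
    have := Bl y; rewrite !inE yx /=; apply.
    by move: yB; rewrite yx.
  split; last by rewrite finset.setU1K //; apply/negP => /Bl; rewrite inE (negbTE xl).
  by apply/fintype.subsetP => y; rewrite !inE => /orP[->//|/Bl]; rewrite inE => ->; rewrite orbT.
move=> _; rewrite finset.setU11 /=; congr (F (_ :: _) _); apply: eq_in_filter => y yl;
  by rewrite !inE; case: eqP yl => [->|//]; rewrite (negbTE xl).
Qed.

(** Both sides are decomposed along the block of the first entry of [enum D]; enumerating a subset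
    keeps the order of [enum D], so each weight sees the same list. *)
Lemma sum_partition_zsum (T : finType) (C : comPzRingType) (psi : seq T -> C)
    (D : {set T}) :
  \sum_(P : {set {set T}} | finset.partition P D) \prod_(B in P) psi (enum B) =
  zsum psi (enum D).
Proof.
have [n] := ubnP #|D|; elim: n D => // n IH D Dn.
case El : (enum D) => [|x l].
  have -> : D = finset.set0 by apply/finset.setP => y; rewrite -mem_enum El !inE.
  rewrite zsum_nil (big_pred1 finset.set0) => [|P]; last exact: finset.partition_set0.
  by rewrite finset.big_set0.
have xD : x \in D by rewrite -mem_enum El mem_head.
have /andP[xl ul] : uniq (x :: l) by rewrite -El enum_uniq.
have Dl : D = (x |: [set y in l])%SET.
  by apply/finset.setP => y; rewrite -mem_enum El !inE.
rewrite (sum_partition_pivot (fun B : {set T} => psi (enum B)) xD) zsum_cons.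
rewrite -(sum_subsets (fun a b => psi (x :: a) * zsum psi b)) //.
rewrite (reindex_onto (fun B => x |: B)%SET (fun B => B :\ x)%SET) /=; last first.
  by move=> B /andP[_ xB]; apply: finset.setD1K.
have fE (B : {set T}) : B \subset D -> enum B = [seq y <- x :: l | y \in B].
  move=> /fintype.subsetP BD; rewrite -El [enum D]/enum_mem -filter_predI.
  apply: eq_filter => y /=; apply/idP/andP => [yB|[] //]; split => //; exact: BD.
apply: eq_big => [B|B /andP[/andP[BD _] /eqP Bx]].
  rewrite finset.setU11 andbT Dl; apply/andP/idP => [[/fintype.subsetP Bl /eqP Bx]|/fintype.subsetP Bl].
    apply/fintype.subsetP => y; rewrite -Bx !inE => /andP[/negbTE yx yB].
    have := Bl y; rewrite !inE yx /=; apply.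
    by move: yB; rewrite yx.
  split; last by rewrite finset.setU1K //; apply/negP => /Bl; rewrite inE (negbTE xl).
  by apply/fintype.subsetP => y; rewrite !inE => /orP[->//|/Bl]; rewrite inE => ->; rewrite orbT.
rewrite IH; last first.
  move: Dn; rewrite ltnS; apply: leq_trans; rewrite proper_card //.
  apply/fintype.properP; split; first exact: finset.subsetDl.
  by exists x => //; rewrite !inE eqxx.
rewrite !fE ?finset.subsetDl //= finset.setU11 !inE eqxx /=.
congr (psi (_ :: _) * zsum psi _); apply: eq_in_filter => y yl; rewrite !inE.
  by case: eqP yl => [->|//]; rewrite (negbTE xl).
have yx : (y == x) = false by case: eqP yl => [->|//]; rewrite (negbTE xl).
by rewrite yx Dl !inE yx yl /= ?andbT.
Qed.

(** * Admissible partitions of words *)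

(* The letters of a word are labelled by the number of letters [w] before them.
   A subword has no inner [w] iff each of its letters [x] is followed by a letter
   with label [after x], so that admissibility is read off the labels alone. *)
Fixpoint lab (g : nat) (s : word) : seq (nat * letter) :=
  match s with
  | [::] => [::]
  | Lz :: s' => (g, Lz) :: lab g s'
  | Lw :: s' => (g, Lw) :: lab g.+1 s'
  end.
Definition after (x : nat * letter) : nat := if x.2 is Lw then x.1.+1 else x.1.
Definition adj (x y : nat * letter) : bool := after x == y.1.
(** A block with an inner [w] has weight 0, so that sums over all set partitions reduce to the
    admissible ones. *)
Definition adm_weight (C : pzRingType) (L : word -> C) (b : seq (nat * letter)) : C :=
  if sorted adj b then L (map snd b) else 0.

Lemma labE g s :
  lab g s = [seq ((g + count_mem Lw (take i s))%N, nth Lz s i) | i <- iota 0 (size s)].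
Proof.
elim: s g => //= a s IH g; rewrite (iotaDl 1 0) -map_comp /= addn0.
case: a; rewrite IH; congr (_ :: _); apply: eq_map => i //=.
by rewrite addnA addn1.
Qed.

Definition ord_lab (s : word) (i : 'I_(size s)) : nat * letter :=
  (count_mem Lw (take i s), tnth (in_tuple s) i).

Lemma lab_ord s : lab 0 s = map (@ord_lab s) (enum 'I_(size s)).
Proof.
rewrite labE -val_enum_ord -map_comp; apply: eq_map => i /=.
by rewrite /ord_lab (tnth_nth Lz) add0n.
Qed.

Lemma count_takeS (s : word) i : (i < size s)%N ->
  count_mem Lw (take i.+1 s) = (count_mem Lw (take i s) + (nth Lz s i == Lw))%N.
Proof. by move=> si; rewrite (take_nth Lz) // -cats1 count_cat /= addn0. Qed.

Lemma after_ord_lab s (i : 'I_(size s)) :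
  after (ord_lab i) = count_mem Lw (take i.+1 s).
Proof.
rewrite count_takeS // /after /ord_lab /= (tnth_nth Lz) /=.
by case: (nth Lz s i); rewrite ?addn0 ?addn1.
Qed.

Lemma count_take_le (s : word) i j : (i <= j)%N ->
  (count_mem Lw (take i s) <= count_mem Lw (take j s))%N.
Proof.
move=> ij; rewrite -(subnKC ij) takeD count_cat; exact: leq_addr.
Qed.

(** For consecutive [u < v] in [enum B], the label of [v] exceeds [after] of [u] by the number of
    letters [w] strictly between them. Those letters are exactly what admissibility forbids. *)
Lemma sorted_adjP s (B : {set 'I_(size s)}) :
  [forall j, inner j B ==> (tnth (in_tuple s) j != Lw)] =
  sorted adj (map (@ord_lab s) (enum B)).
Proof.
have sB : sorted (fun i j : 'I_(size s) => (i < j)%N) (enum B).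
  have : sorted (fun i j : 'I_(size s) => (i < j)%N) (enum 'I_(size s)).
    by have := iota_ltn_sorted 0 (size s); rewrite -val_enum_ord sorted_map.
  rewrite [enum B]/enum_mem enumT.
  by apply: (@sorted_filter _ (fun i j : 'I_(size s) => (i < j)%N)) => y x z; apply: ltn_trans.
rewrite sorted_map; apply/forallP/idP => [h|h j].
  case Ee : (enum B) sB => [//|x0 e] sB; rewrite -Ee in sB *.
  have ltE : {in gtn (size (enum B)) &, forall i k,
      (i < k)%N -> (nth x0 (enum B) i < nth x0 (enum B) k)%N}.
    by apply: (@sorted_ltn_nth _ (fun i j : 'I_(size s) => (i < j)%N)) => // y x z; apply: ltn_trans.
  apply/(sortedP x0) => i ie.
  have ie' := ltnW ie.
  set u := nth x0 (enum B) i; set v := nth x0 (enum B) i.+1.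
  have uv : (u < v)%N by apply: ltE.
  rewrite /= /adj after_ord_lab /ord_lab /= -(subnKC uv) takeD count_cat.
  rewrite -[X in X == _]addn0 eqn_add2l eq_sym -leqn0 leqNgt -has_count.
  apply/negP => /(has_nthP Lz)[k ks].
  have kv : (k < v - u.+1)%N by apply: leq_trans ks _; rewrite size_take_min geq_minl.
  rewrite /= nth_take // nth_drop => /eqP kw.
  have jv : (u.+1 + k < v)%N by rewrite -ltn_subRL.
  have js : (u.+1 + k < size s)%N by apply: ltn_trans jv (ltn_ord v).
  have uB : u \in B by rewrite -mem_enum mem_nth.
  have vB : v \in B by rewrite -mem_enum mem_nth.
  have := h (Ordinal js); rewrite (tnth_nth Lz) /= kw eqxx implybF => /negP; apply.
  apply/and3P; split.
  - rewrite -mem_enum; apply/negP => /(nthP x0)[m me mE].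
    have mE' : nat_of_ord (nth x0 (enum B) m) = (u.+1 + k)%N by rewrite mE.
    have [mi|im|mi] := ltngtP m i.
    + have := ltE _ _ me ie' mi; rewrite mE' -/u.
      by rewrite ltnNge addSn leqW // leq_addr.
    + move: im; rewrite leq_eqVlt => /orP[/eqP mi|im].
        by move: mE' jv; rewrite -mi -/v => ->; rewrite ltnn.
      have := ltE _ _ ie me im; rewrite mE' -/v => /(ltn_trans jv).
      by rewrite ltnn.
    + move: mE'; rewrite mi -/u => /eqP; rewrite addSn -addnS -{1}[nat_of_ord u]addn0.
      by rewrite eqn_add2l.
  - by apply/existsP; exists u; rewrite uB /= addSn ltnS leq_addr.
  - by apply/existsP; exists v; rewrite vB.
apply/implyP => /and3P[jB /existsP[i /andP[iB ij]] /existsP[k /andP[kB jk]]].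
apply/eqP => jw.
have jw' : nth Lz s j = Lw by rewrite -jw (tnth_nth Lz).
(* An increasing chain with matching labels that starts below [j] and avoids [j] never jumps over
   it: the [w] at [j] would raise the next label. *)
have lei : forall l x, path (fun x y => adj (ord_lab x) (ord_lab y)) x l ->
    path (fun i j : 'I_(size s) => (i < j)%N) x l ->
    (x < j)%N -> j \notin l -> ~~ has (fun y : 'I_(size s) => (j < y)%N) l.
  elim=> //= y l IH x /andP[a1 p1] /andP[xy p2] xj; rewrite inE negb_or => /andP[jy jl].
  have yj : (y < j)%N.
    rewrite ltn_neqAle eq_sym (inj_eq val_inj) jy /= leqNgt; apply/negP => jy'.
    move: a1; rewrite /adj after_ord_lab /= => /eqP e1.
    have := count_take_le s jy'; rewrite count_takeS // jw' eqxx -e1 addn1.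
    by rewrite ltnNge count_take_le.
  by rewrite negb_or -leqNgt ltnW //= (IH y).
have : i \in enum B by rewrite mem_enum.
case/splitPr El : _ / => [l1 l2].
have l2s : {subset l2 <= B} by move=> y yl; rewrite -mem_enum El mem_cat inE yl !orbT.
have jl2 : j \notin l2 by apply: contra jB => /l2s.
have p1 : path (fun i j : 'I_(size s) => (i < j)%N) i l2.
  by move: sB; rewrite El => /cat_sorted2[_].
have p2 : path (fun x y => adj (ord_lab x) (ord_lab y)) i l2.
  by move: h; rewrite El => /cat_sorted2[_].
have /negP := lei _ _ p2 p1 ij jl2; apply; apply/hasP; exists k => //.
have : k \in enum B by rewrite mem_enum.
rewrite El mem_cat inE => /or3P[kl1|/eqP ki|//].
  have : (k < i)%N.
    move: sB; rewrite El sorted_pairwise; last by move=> y x z; apply: ltn_trans.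
    by rewrite pairwise_cat => /and3P[/allrelP h' _ _]; apply: h' => //; rewrite mem_head.
  by move=> /(ltn_trans jk) /(ltn_trans ij); rewrite ltnn.
by move: (ltn_trans ij jk); rewrite ki ltnn.
Qed.

(** Positions are replaced by their labels through [zsum_map]; each partition that is not admissible
    contains a block of weight 0 and may be added to the sum. *)
Lemma sum_AP (C : comPzRingType) (L : word -> C) (s : word) :
  \sum_(P in AP s) \prod_(B in P) L (subword B) = zsum (adm_weight L) (lab 0 s).
Proof.
rewrite lab_ord zsum_map -[enum 'I_(size s)]/(enum (mem 'I_(size s))).
have -> : enum (mem 'I_(size s)) = enum [set: 'I_(size s)]%SET.
  by rewrite finset.enum_setT enumT.
rewrite -sum_partition_zsum.
under eq_bigl => P do rewrite inE.
rewrite [LHS]big_mkcond [RHS]big_mkcond; apply: eq_bigr => P _.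
rewrite /admissible; case: finset.partition => //=.
case: ifP => [/forallP h|/negbT/forallPn[B]].
  apply: eq_bigr => B BP; have := h B; rewrite BP /= sorted_adjP => sB.
  rewrite /adm_weight /= sB -map_comp; congr L; exact: eq_map.
rewrite negb_imply => /andP[BP]; rewrite sorted_adjP => sB.
by rewrite (bigD1 B) //= /adm_weight (negbTE sB) mul0r.
Qed.

Lemma word_gap (s : word) :
  (exists n, s = zpow n) \/ (exists n t, s = zpow n ++ Lw :: t).
Proof.
elim: s => [|[] s IH]; first by left; exists 0%N.
  case: IH => [[n ->]|[n [t ->]]]; first by left; exists n.+1.
  by right; exists n.+1, t.
by right; exists 0%N, s.
Qed.

Lemma word_gap_ind (P : word -> Prop) :
  (forall n, P (zpow n)) -> (forall n t, P t -> P (zpow n ++ Lw :: t)) ->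
  forall s, P s.
Proof.
move=> P0 P1 s; have [n] := ubnP (size s); elim: n s => // n IH s.
case: (word_gap s) => [[m ->]|[m [t ->]]] // sz; apply: P1; apply: IH.
by move: sz; rewrite ltnS size_cat /= addnS; apply: leq_trans; rewrite ltnS leq_addl.
Qed.

(** * Recursions for moments along the block of the first [w] *)

Section WordRecursion.
Variables (C : comPzRingType) (M L : word -> C).
Hypotheses (ML : is_cumulants M L) (M1 : M [::] = 1).
Implicit Types (a s t : word).
Local Notation phi := (adm_weight L).
Local Notation cw s := (count_mem Lw s).

Lemma lab_cat g s t : lab g (s ++ t) = lab g s ++ lab (g + cw s)%N t.
Proof.
elim: s g => [|[] s IH] g /=; rewrite ?addn0 //= IH //.
by rewrite addnA addn1.
Qed.

Lemma lab_zpow g n : lab g (zpow n) = nseq n (g, Lz).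
Proof. by elim: n => //= n ->. Qed.

Lemma map_snd_lab g s : map snd (lab g s) = s.
Proof. by elim: s g => [|[] s IH] g //=; rewrite IH. Qed.

Lemma cw_zpow n : cw (zpow n) = 0%N.
Proof. by elim: n. Qed.

Lemma sorted_lab g s : sorted adj (lab g s).
Proof.
have H x : path adj x (lab (after x) s) by
  elim: s x => [|[] s IH] x //=; rewrite /adj eqxx /=; [exact: (IH (_, Lz)) | exact: (IH (_, Lw))].
by have := H (g, Lz) => /path_sorted.
Qed.

Lemma mem_lab g s x : x \in lab g s -> (g <= x.1)%N /\ (after x <= g + cw s)%N.
Proof.
elim: s g => [|[] s IH] g //=; rewrite inE => /orP[/eqP->|/IH[h1 h2]];
  rewrite /= ?add0n ?add1n ?addnS -?addSn; split=> //=; rewrite /after ?leq_addr //.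
exact: ltnW.
Qed.

Lemma adm_weight_lab g s : phi (lab g s) = L s.
Proof. by rewrite /adm_weight sorted_lab map_snd_lab. Qed.

(** At the junction, [adj] would equate [after] of the last entry of [b1], at most [g], with a label
    above [g]. *)
Lemma adm_weight_gap g (b1 b2 : seq (nat * letter)) :
  (forall x, x \in b1 -> after x <= g)%N -> (forall y, y \in b2 -> g < y.1)%N ->
  b1 != [::] -> b2 != [::] -> phi (b1 ++ b2) = 0.
Proof.
case: b1 => // x b1; case: b2 => // y b2 h1 h2 _ _.
rewrite /adm_weight ifF //=; apply/negP; rewrite cat_path /= => /and3P[_ /eqP e _].
have := h1 _ (mem_last x b1); rewrite e leqNgt => /negP; apply; apply: h2.
exact: mem_head.
Qed.

(** [adj] only compares labels with each other, so shifting all of them by [g] is harmless; at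
    [g = 0] this is the defining relation of the cumulants. *)
Lemma zsum_lab g s : zsum phi (lab g s) = M s.
Proof.
have -> : lab g s = map (fun x => (g + x.1, x.2)%N) (lab 0 s).
  by rewrite !labE -map_comp; apply: eq_map => i.
rewrite zsum_map; transitivity (zsum phi (lab 0 s)).
  congr zsum; apply/funext => b; rewrite /adm_weight /= -map_comp sorted_map.
  rewrite (@eq_sorted _ _ adj) // => -[g1 a1] [g2 a2].
  rewrite /adj /after /=; case: a1 => /=; first exact: eqn_add2l.
  by rewrite -addnS eqn_add2l.
case: s => [|x s]; first by rewrite zsum_nil M1.
by rewrite -sum_AP -ML.
Qed.

(* The part of M(a t) due to the partitions with a block that contains all of a. *)
Definition ext a t : C :=
  \sum_(p <- splits (lab (cw a) t)) phi (lab 0 a ++ p.1) * zsum phi p.2.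

(** The z's with label [g] cannot share a block with letters beyond the next [w]; they are
    partitioned among themselves. *)
Lemma zsum_gap g n (b : seq (nat * letter)) : (forall y, y \in b -> g < y.1)%N ->
  zsum phi (nseq n (g, Lz) ++ b) = M (zpow n) * zsum phi b.
Proof.
move=> h; rewrite zsum_cat -?lab_zpow ?zsum_lab // => b1 b2 h1 h2.
apply: (@adm_weight_gap g) => [x /h1|y /h2 /h //].
by rewrite lab_zpow mem_nseq => /andP[_ /eqP->].
Qed.

(** The block of the first [w] takes [k] of the [n] leading z's, in ['C(n, k)] ways; the others are
    separated from [t] by that [w] and contribute a factor of their own. *)
Lemma moment_gap n t :
  M (zpow n ++ Lw :: t) =
  \sum_(k < n.+1) (ext (zpow k ++ [:: Lw]) t * M (zpow (n - k))) *+ 'C(n, k).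
Proof.
rewrite -(zsum_lab 0) lab_cat lab_zpow cw_zpow zsum_pivot.
rewrite (sum_splits_nseq n (0%N, Lz) (fun b r => \sum_(q <- splits (lab 1 t))
  phi (b ++ (0%N, Lw) :: q.1) * zsum phi (r ++ q.2))).
apply: eq_bigr => k _; congr (_ *+ _).
rewrite /ext lab_cat count_cat cw_zpow /= lab_zpow mulr_suml.
rewrite big_seq [RHS]big_seq; apply: eq_bigr => q /mem_splits[_ qs].
rewrite zsum_gap => [|y /qs /mem_lab[]//].
by rewrite -mulrA [M _ * _]mulrC -catA.
Qed.

Lemma ext_zpow a n :
  ext a (zpow n) = \sum_(k < n.+1) (L (a ++ zpow k) * M (zpow (n - k))) *+ 'C(n, k).
Proof.
rewrite /ext lab_zpow (sum_splits_nseq n _ (fun b r => phi (lab 0 a ++ b) * zsum phi r)).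
apply: eq_bigr => k _; congr (_ *+ _).
by rewrite -!lab_zpow zsum_lab -[cw a]add0n -lab_cat adm_weight_lab.
Qed.

(** The block through [a] takes [k] z's of the gap. Either it ends there, and the remaining letters
    form an arbitrary admissible partition, or it takes the next [w] and isolates the other [n - k]
    z's. *)
Lemma ext_gap a n t : a != [::] ->
  ext a (zpow n ++ Lw :: t) =
  \sum_(k < n.+1) (L (a ++ zpow k) * M (zpow (n - k) ++ Lw :: t) +
     ext (a ++ zpow k ++ [:: Lw]) t * M (zpow (n - k))) *+ 'C(n, k).
Proof.
move=> a0; rewrite /ext lab_cat cw_zpow addn0 lab_zpow; set g := cw a.
rewrite (sum_splits_cat _ _ (fun b r => phi (lab 0 a ++ b) * zsum phi r)).
rewrite (sum_splits_nseq n (g, Lz) (fun b r => \sum_(q <- splits (lab g (Lw :: t)))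
  phi (lab 0 a ++ b ++ q.1) * zsum phi (r ++ q.2))).
apply: eq_bigr => k _; congr (_ *+ _).
have labak : lab 0 a ++ nseq k (g, Lz) = lab 0 (a ++ zpow k).
  by rewrite lab_cat -lab_zpow.
rewrite /= (sum_splits_cons _ _ (fun b r =>
  phi (lab 0 a ++ nseq k (g, Lz) ++ b) * zsum phi (nseq (n - k) (g, Lz) ++ r))).
rewrite addrC; congr (_ + _).
  (* A block that contains [a] and omits this [w] cannot contain a later letter. *)
  rewrite (sum_splits_only_nil (F := fun b r =>
    phi (lab 0 a ++ nseq k (g, Lz) ++ b) * zsum phi (nseq (n - k) (g, Lz) ++ (g, Lw) :: r))).
    rewrite cats0 labak adm_weight_lab -(zsum_lab g (zpow _ ++ _)).
    by rewrite lab_cat cw_zpow addn0 lab_zpow.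
  move=> q /mem_splits[qs _] q0; rewrite catA labak (@adm_weight_gap g) ?mul0r //.
  - by move=> x /mem_lab[_]; rewrite count_cat cw_zpow addn0.
  - by move=> y /qs /mem_lab[].
  - by case: (a) a0 => // -[].
rewrite mulr_suml catA lab_cat count_cat count_cat cw_zpow addn0 /= addn1 -labak.
rewrite big_seq [RHS]big_seq; apply: eq_bigr => q /mem_splits[_ qs].
rewrite zsum_gap => [|y /qs /mem_lab[]//].
by rewrite add0n -mulrA [M _ * _]mulrC -!catA.
Qed.
End WordRecursion.

(** * The identity in the semigroup algebra *)

Lemma blocks_gap n t : blocks (zpow n ++ Lw :: t) =
  match blocks t with
  | ((0%N, k) :: b, m) => ((n, k.+1) :: b, m)
  | (b, m) => ((n, 1%N) :: b, m)
  end.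
Proof.
elim: n => [//|n /=]; rewrite -/(zpow n) => ->.
by case: (blocks t) => [[|[[|j] k] b] m].
Qed.

Lemma blocks_zpow n : blocks (zpow n) = ([::], n).
Proof. exact: (@assembleK [::]). Qed.

Lemma nfact_zpow n : nfact (zpow n) = n`!.
Proof. by rewrite /nfact blocks_zpow big_nil mul1n. Qed.

(** An empty gap inside a run of w's contributes 0! = 1, so the product may be taken gap by gap. *)
Lemma nfact_gap n t : nfact (zpow n ++ Lw :: t) = (n`! * nfact t)%N.
Proof.
rewrite /nfact blocks_gap.
by case: (blocks t) => [[|[[|j] k] b] m] /=; rewrite ?big_cons /= ?fact0 ?mul1n ?mulnA.
Qed.

(** With the default [Lw], the hypothesis says that [a] is empty or ends in [Lw], so no run of z's
    straddles the junction. *)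
Lemma nfact_cat a t : last Lw a = Lw -> nfact (a ++ t) = (nfact a * nfact t)%N.
Proof.
elim/word_gap_ind: a => [n|n a IH]; last first.
  by rewrite last_cat /= => /IH e; rewrite -catA /= !nfact_gap e mulnA.
case: n => [_|n]; first by rewrite nfact_zpow fact0 mul1n.
by have /= -> : last Lw (zpow n.+1) = Lz by rewrite /=; elim: n.
Qed.

Lemma zword_zpow n : zword (zpow n).
Proof. by elim: n. Qed.

Lemma zword_gap n t : zword (zpow n ++ Lw :: t) = false.
Proof. by rewrite /zword all_cat /= andbF. Qed.

(** * Power series in [z], and products in A(S) gap by gap *)

Definition cauchy (C : pzRingType) (f g : nat -> C) (n : nat) : C :=
  \sum_(k < n.+1) f k * g (n - k)%N.

Section Cauchy.
Variable C : fieldType.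
Implicit Types f g h : nat -> C.

(** Sequences are embedded in A(S) as functions of the length, from which [cauchy] inherits
    associativity. *)
Let ser f : wseries C := fun s => f (size s).

Lemma cauchy_ser f g : ser f * ser g = ser (cauchy f g).
Proof.
apply/funext => s; rewrite wmulE /ser /cauchy; apply: eq_bigr => i _.
by rewrite size_drop size_takel // -ltnS.
Qed.

Lemma cauchyA f g h : cauchy (cauchy f g) h =1 cauchy f (cauchy g h).
Proof.
move=> n; have := mulrA (ser f) (ser g) (ser h); rewrite !cauchy_ser.
by move/(congr1 (@^~ (zpow n))); rewrite /ser size_nseq.
Qed.

Lemma eq_cauchy f f' g g' n : f =1 f' -> g =1 g' -> cauchy f g n = cauchy f' g' n.
Proof. by move=> e e'; apply: eq_bigr => i _; rewrite e e'. Qed.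

Lemma cauchy1 f n : cauchy f (fun m => (m == 0%N)%:R) n = f n.
Proof.
rewrite /cauchy big_ord_recr /= subnn mulr1 big1 ?add0r // => i _.
by rewrite subn_eq0 leqNgt ltn_ord mulr0.
Qed.

Lemma wmul_zpow (f g : wseries C) n :
  (f * g) (zpow n) = cauchy (fun k => f (zpow k)) (fun k => g (zpow k)) n.
Proof.
rewrite wmulE size_nseq; apply: eq_bigr => i _.
by rewrite take_nseq ?drop_nseq // -ltnS.
Qed.

Lemma wmul_gap (f g : wseries C) n t :
  (f * g) (zpow n ++ Lw :: t) =
  cauchy (fun k => f (zpow k)) (fun k => g (zpow k ++ Lw :: t)) n +
  \sum_(i < (size t).+1) f (zpow n ++ Lw :: take i t) * g (drop i t).
Proof.
rewrite wmulE size_cat size_nseq /= -addSn big_split_ord /=; congr (_ + _).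
  apply: eq_bigr => i _; have iN : (i <= n)%N by rewrite -ltnS.
  rewrite takel_cat ?size_nseq // take_nseq // drop_cat size_nseq.
  case: ltngtP iN => // [ni|ni] _; first by rewrite drop_nseq.
  by rewrite ni subnn drop0.
apply: eq_bigr => i _; rewrite take_cat drop_cat size_nseq addSn ltnNge.
by rewrite leqW ?leq_addr //= subSn ?leq_addr // addKn.
Qed.

End Cauchy.

(** * The operation f_{*g} along the gaps *)

Section Star.
Variables (C : fieldType) (g : wseries C).
Hypothesis g1 : g [::] = 1.

Lemma fstar_rec_prefix (f : wseries C) pre p b m :
  fstar_rec f g (pre ++ p) b m = fstar_rec (fun s => f (pre ++ s)) g p b m.
Proof.
elim: b p => [|[n k] b IH] p /=; first by rewrite catA.
by apply: eq_bigr => i _; rewrite -catA IH.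
Qed.

(** If [t] starts with [Lw], [blocks] merges the two runs, whereas [fstar] on [t] alone still sees
    an empty gap; its factor is [g [::] = 1]. *)
Lemma fstar_gap (f : wseries C) n t :
  fstar f g (zpow n ++ Lw :: t) =
  cauchy (fun k => fstar (fun s => f (zpow k ++ Lw :: s)) g t) (fun k => g (zpow k)) n.
Proof.
have E k p b m : fstar_rec f g (zpow k ++ Lw :: p) b m =
    fstar_rec (fun s => f (zpow k ++ Lw :: s)) g p b m.
  rewrite -cat_rcons fstar_rec_prefix; congr fstar_rec.
  by apply/funext => s; rewrite cat_rcons.
rewrite /fstar blocks_gap; case: (blocks t) => [[|[[|j] k] b] m] /=;
  apply: eq_bigr => i _; congr (_ * _); rewrite ?E ?cats0 //.
- by rewrite -catA.
- by rewrite big_ord1 /= g1 mulr1.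
- exact: (E i [::] ((j.+1, k) :: b) m).
Qed.

Lemma fstar_sum n (c : 'I_n -> C) (X : 'I_n -> wseries C) t :
  fstar (fun s => \sum_i X i s * c i) g t = \sum_i fstar (X i) g t * c i.
Proof.
rewrite /fstar; elim: (blocks t).1 [::] => [//|[j k] b IH] pre /=.
under [RHS]eq_bigr => i _ do rewrite mulr_suml.
rewrite exchange_big; apply: eq_bigr => a _.
by rewrite IH mulr_suml; apply: eq_bigr => i _; rewrite mulrAC.
Qed.

Lemma fstarD (f f' : wseries C) t :
  fstar (fun s => f s + f' s) g t = fstar f g t + fstar f' g t.
Proof.
rewrite /fstar; elim: (blocks t).1 [::] => [//|[j k] b IH] pre /=.
by rewrite -big_split; apply: eq_bigr => a _; rewrite IH mulrDl.
Qed.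

End Star.

(** * The recursion for M_* and the algebraic identity *)

Section Identity.
Variables (C : numFieldType) (M L : word -> C).
Hypotheses (ML : is_cumulants M L) (M1 : M [::] = 1).
Local Notation Mh := (Mgf M).
Local Notation g := (zpart (Mgf M))^-1.
Local Notation gz := (fun k => g (zpow k)).
Local Notation mz := (fun k => Mh (zpow k)).

(** Dividing by both factorials turns the binomial recursions for [ext] into Cauchy products. *)
Let nex a t : C := ext L a t / (nfact a * nfact t)%:R.
Let Lh s : C := L s / (nfact s)%:R.

Lemma Mgf1 : Mh [::] = 1.
Proof. by rewrite /Mgf M1 (nfact_zpow 0) divr1. Qed.

Lemma Mz0_unit : zpart Mh \is a GRing.unit.
Proof. by rewrite wunitE /zpart /= Mgf1 oner_neq0. Qed.

Lemma mz_gz n : cauchy mz gz n = (n == 0%N)%:R.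
Proof.
have := congr1 (@^~ (zpow n)) (divrr Mz0_unit); rewrite wmul_zpow woneE.
rewrite (eq_cauchy (f' := mz) (g' := gz)) // => [->|k]; first by case: n.
by rewrite /zpart zword_zpow.
Qed.

Lemma gz1 : g [::] = 1.
Proof.
by have := mz_gz 0; rewrite /cauchy big_ord1 /= Mgf1 mul1r.
Qed.

(** This is 'C(n, k) / n! = 1 / (k! (n - k)!), where [p] and [q] are left free for the factorials of
    the other letters. *)
Lemma binom_div (x y : C) n k p q : (k <= n)%N ->
  (x * y) *+ 'C(n, k) / (n`! * (p * q))%:R =
  x / (k`! * p)%:R * (y / ((n - k)`! * q)%:R).
Proof.
move=> kn; have C0 : 'C(n, k)%:R != 0 :> C by rewrite pnatr_eq0 -lt0n bin_gt0.
rewrite mulrACA -invfM -natrM mulnACA -(bin_fact kn) -!mulnA natrM -mulr_natr.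
by rewrite invfM mulrA mulfK.
Qed.

Lemma Mgf_gap n t :
  Mh (zpow n ++ Lw :: t) = cauchy (fun k => nex (zpow k ++ [:: Lw]) t) mz n.
Proof.
rewrite /Mgf (moment_gap ML M1) nfact_gap mulr_suml; apply: eq_bigr => k _.
rewrite -[nfact t]muln1 binom_div -1?ltnS // /nex nfact_gap nfact_zpow.
by rewrite (nfact_zpow 0) fact0 !muln1.
Qed.

Lemma nex_zpow a n : last Lw a = Lw ->
  nex a (zpow n) = cauchy (fun k => Lh (a ++ zpow k)) mz n.
Proof.
move=> aw; rewrite /nex (ext_zpow ML M1) nfact_zpow mulr_suml; apply: eq_bigr => k _.
rewrite -[nfact a]muln1 mulnC binom_div -1?ltnS // /Lh /Mgf nfact_cat // !nfact_zpow.
by rewrite muln1 [(nfact a * _)%N]mulnC.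
Qed.

Lemma nex_gap a n t : last Lw a = Lw -> a != [::] ->
  nex a (zpow n ++ Lw :: t) =
  cauchy (fun k => Lh (a ++ zpow k)) (fun k => Mh (zpow k ++ Lw :: t)) n +
  cauchy (fun k => nex (a ++ zpow k ++ [:: Lw]) t) mz n.
Proof.
move=> aw a0; rewrite /nex (ext_gap ML M1) // nfact_gap mulr_suml -big_split.
apply: eq_bigr => k _; rewrite mulrnDl mulrDl mulnCA; congr (_ + _).
  rewrite binom_div -1?ltnS // /Lh /Mgf nfact_cat // nfact_zpow nfact_gap.
  by rewrite [(nfact a * _)%N]mulnC.
rewrite /Mgf -[(nfact a * nfact t)%N]muln1 binom_div -1?ltnS // nfact_zpow !muln1.
rewrite nfact_cat // nfact_gap (nfact_zpow 0) fact0 muln1.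
by rewrite mulnCA mulnA.
Qed.

(** Convolution with [g] cancels, gap by gap, the factor of the z's left out of the block. What
    survives is the block [a ++ take i t], which takes every letter up to the place where it
    ends. *)
Lemma fstar_nex a t : last Lw a = Lw -> a != [::] ->
  fstar (nex a) g t = \sum_(i < (size t).+1) Lh (a ++ take i t) * Mstar M (drop i t).
Proof.
elim/word_gap_ind: t a => [n|n t IH] a aw a0.
  rewrite fstar_zword nex_zpow // size_nseq; apply: eq_bigr => i _.
  by rewrite take_nseq ?drop_nseq -1?ltnS // /Mstar fstar_zword.
rewrite fstar_gap ?gz1 //.
have aw' k : last Lw (a ++ zpow k ++ [:: Lw]) = Lw by rewrite !last_cat.
have aw0 k : a ++ zpow k ++ [:: Lw] != [::] by case: (a) a0.
transitivity (cauchy (fun u =>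
    cauchy (fun k => Lh (a ++ zpow k))
           (fun k => fstar (fun s => Mh (zpow k ++ Lw :: s)) g t) u +
    cauchy (fun k => fstar (nex (a ++ zpow k ++ [:: Lw])) g t) mz u) gz n).
  apply: eq_cauchy => // u.
  under [X in fstar X _ _]funext => s do rewrite nex_gap // /cauchy.
  rewrite fstarD // fstar_sum //; congr (_ + _).
  under [X in fstar X _ _]funext => s do under eq_bigr => k _ do rewrite mulrC.
  by rewrite fstar_sum; apply: eq_bigr => k _; rewrite mulrC.
rewrite {1}/cauchy; under eq_bigr => u _ do rewrite mulrDl.
rewrite big_split -!/(cauchy _ gz n) !cauchyA.
(* In the second sum [mz] meets its inverse [gz] and disappears; in the first one, [gz] completes
   the moments to [Mstar] by [fstar_gap]. *)
rewrite (eq_cauchy (f' := fun k => fstar (nex (a ++ zpow k ++ [:: Lw])) g t)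
  (g' := fun m => (m == 0%N)%:R) n _ mz_gz) // cauchy1 IH //.
rewrite size_cat size_nseq /= -addSn big_split_ord /=; congr (_ + _).
  apply: eq_bigr => i _; have iN : (i <= n)%N by rewrite -ltnS.
  rewrite -fstar_gap ?gz1 // takel_cat ?size_nseq // take_nseq //; congr (_ * fstar _ _ _).
  rewrite drop_cat size_nseq; case: ltngtP iN => // [ni|->] _; first by rewrite drop_nseq.
  by rewrite subnn drop0.
apply: eq_bigr => i _; rewrite take_cat drop_cat size_nseq addSn ltnNge.
by rewrite leqW ?leq_addr //= subSn ?leq_addr // addKn -!catA.
Qed.

Lemma Mstar_zpow n : Mstar M (zpow n) = Mh (zpow n).
Proof. exact: fstar_zword. Qed.

Lemma Mstar1 : Mstar M [::] = 1.
Proof. by rewrite (Mstar_zpow 0) Mgf1. Qed.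

Lemma Mstar_gap n t : Mstar M (zpow n ++ Lw :: t) =
  \sum_(i < (size t).+1) Lh (zpow n ++ Lw :: take i t) * Mstar M (drop i t).
Proof.
rewrite /Mstar fstar_gap ?gz1 //.
transitivity (cauchy (cauchy (fun k => fstar (nex (zpow k ++ [:: Lw])) g t) mz) gz n).
  apply: eq_cauchy => // u.
  by under [X in fstar X _ _]funext => s do rewrite Mgf_gap /cauchy; rewrite fstar_sum.
rewrite cauchyA (eq_cauchy (f' := fun k => fstar (nex (zpow k ++ [:: Lw])) g t)
  (g' := fun m => (m == 0%N)%:R) n _ mz_gz) // cauchy1 fstar_nex.
- by apply: eq_bigr => i _; rewrite -catA.
- by rewrite last_cat.
- by case: (n).
Qed.

(** On powers of [z] both sides vanish. On other words the cuts within the first gap meet a zero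
    coefficient of [Lgf L - zpart (Lgf L)], and the later cuts are those of [Mstar_gap]. *)
Lemma Lgf_Mstar_mul :
  (Lgf L - zpart (Lgf L)) * Mstar M = Mstar M - zpart Mh.
Proof.
have dE (f f' : wseries C) s : (f - f') s = f s - f' s by [].
apply/funext => s; rewrite dE; case: (word_gap s) => [[n ->]|[n [t ->]]].
  rewrite wmul_zpow Mstar_zpow /zpart zword_zpow subrr.
  by apply: big1 => k _; rewrite dE /zpart zword_zpow subrr mul0r.
rewrite wmul_gap /zpart zword_gap subr0 Mstar_gap.
rewrite [X in X + _]big1 ?add0r => [|k _]; last first.
  by rewrite dE zword_zpow subrr mul0r.
apply: eq_bigr => i _; rewrite dE zword_gap subr0 /Lgf /Lh.
by case: (n).
Qed.

Lemma Lgf_Mstar :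
  Lgf L = zpart (Lgf L) + (Mstar M - zpart Mh) * (Mstar M)^-1.
Proof.
have uM : Mstar M \is a GRing.unit by rewrite wunitE Mstar1 oner_neq0.
by rewrite -Lgf_Mstar_mul mulrK // addrC subrK.
Qed.

End Identity.

(** * Weighted norms *)

Section Esum.
Variable R : realType.
Local Open Scope ereal_scope.
Local Open Scope classical_set_scope.

Lemma exchange_esum (T1 T2 : choiceType) (I : set T1) (J : set T2)
    (a : T1 -> T2 -> \bar R) : (forall i j, 0 <= a i j) ->
  \esum_(i in I) \esum_(j in J) a i j = \esum_(j in J) \esum_(i in I) a i j.
Proof.
move=> a0; rewrite !esum_esum //.
rewrite (reindex_esum (I `*`` (fun=> J)) _ (fun k => (k.2, k.1))) //.
split=> [[i j] [] //|[i j] [i' j'] _ _ /= [-> ->] //|[j i] [/= Jj Ii]].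
by exists (i, j).
Qed.

Lemma esumZl_le (T : choiceType) (I : set T) (c : R) (a : T -> \bar R) :
  (0 <= c)%R -> (forall i, 0 <= a i) ->
  \esum_(i in I) c%:E * a i <= c%:E * \esum_(i in I) a i.
Proof.
move=> c0 a0; apply: ge_ereal_sup => _ [X [finX XI]] <-.
rewrite -ge0_mule_fsumr //; apply: lee_wpmul2l; first by rewrite lee_fin.
by apply: esum_ge; exists X.
Qed.

Lemma esum_subset (T : choiceType) (I J : set T) (a : T -> \bar R) :
  I `<=` J -> \esum_(i in I) a i <= \esum_(i in J) a i.
Proof.
move=> IJ; apply: ge_ereal_sup => _ [X [finX XI]] <-.
by apply: esum_ge; exists X => //; split => //; apply: subset_trans XI IJ.
Qed.

Lemma esum_ord (n : nat) (a : nat -> \bar R) : (forall i, 0 <= a i) ->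
  \sum_(i < n) a i = \esum_(i in `I_n) a i.
Proof.
move=> a0; by rewrite fsbig_ord -esum_fset //; exact: finite_II.
Qed.

Lemma esum_cauchy (a : nat -> nat -> \bar R) : (forall i j, 0 <= a i j) ->
  \esum_(n in setT) \sum_(k < n.+1) a k (n - k)%N =
  \esum_(i in setT) \esum_(j in setT) a i j.
Proof.
move=> a0; under eq_esum => n _ do
  rewrite (esum_ord _ (a := fun k => a k (n - k)%N)) //.
rewrite !esum_esum // [RHS](reindex_esum (setT `*`` (fun n => `I_n.+1)) _
  (fun p => (p.2, p.1 - p.2)%N)) //.
split=> [//|[n k] [n' k']|[i j] _].
  rewrite !inE /= => -[_ kn] [_ kn'] [e1 e2]; congr (_, _) => //.
  by rewrite -(subnK (m := k) (n := n)) // e2 e1 subnK.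
exists (i + j, i)%N; rewrite /= ?addKn //; split => //.
by rewrite /= ltnS leq_addr.
Qed.

Lemma esum_take_drop (T : choiceType) (a : seq T -> seq T -> \bar R) :
  (forall u v, 0 <= a u v) ->
  \esum_(s in setT) \sum_(i < (size s).+1) a (take i s) (drop i s) =
  \esum_(u in setT) \esum_(v in setT) a u v.
Proof.
move=> a0; under eq_esum => s _ do
  rewrite (esum_ord _ (a := fun k => a (take k s) (drop k s))) //.
rewrite !esum_esum // [RHS](reindex_esum (setT `*`` (fun s : seq T => `I_(size s).+1)) _
  (fun p => (take p.2 p.1, drop p.2 p.1))) //.
split=> [//|[s k] [s' k']|[u v] _].
  rewrite !inE /= => -[_ ks] [_ ks'] [e1 e2].
  have -> : s = s' by rewrite -(cat_take_drop k s) e1 e2 cat_take_drop.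
  by congr (_, _); have := congr1 size e1; rewrite !size_takel.
exists (u ++ v, size u); rewrite /= ?take_size_cat ?drop_size_cat //; split => //.
by rewrite /= ltnS size_cat leq_addr.
Qed.

End Esum.

(** * Submultiplicativity and inverses for the weighted norm *)

Section WeightedNormTheory.
Variable R : realType.
Implicit Types (W : word -> R) (f g : wseries R[i]).
Local Notation nrm := ComplexField.Normc.normc.

Lemma nrm_ge0 (x : R[i]) : 0 <= nrm x.
Proof. by case: x => a b; exact: Num.Theory.sqrtr_ge0. Qed.

Lemma nrmD (x y : R[i]) : nrm (x + y) <= nrm x + nrm y.
Proof. exact: le_normcD. Qed.

Lemma nrm_sum (I : Type) (r : seq I) (F : I -> R[i]) :
  nrm (\sum_(i <- r) F i) <= \sum_(i <- r) nrm (F i).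
Proof.
elim/big_rec2: _ => [|i x y _ h]; first by rewrite ComplexField.Normc.normc0.
by apply: le_trans (nrmD _ _) _; rewrite lerD2l.
Qed.

Lemma weight_ge0 W s : is_weight W -> 0 <= W s.
Proof. by case=> W0 _; exact: ltW. Qed.

Lemma wterm_ge0 W f s : is_weight W -> (0 <= (W s * nrm (f s))%R%:E)%E.
Proof. by move=> Ww; rewrite lee_fin mulr_ge0 ?nrm_ge0 ?weight_ge0. Qed.

Lemma wnorm_ge0 W f D : is_weight W -> (0 <= wnorm D W f)%E.
Proof. by move=> Ww; apply: esum_ge0 => s _; exact: wterm_ge0. Qed.

Lemma le_wnorm W W' f g D : is_weight W ->
  (forall s, 0 <= W' s <= W s) -> (forall s, nrm (f s) <= nrm (g s)) ->
  (wnorm D W' f <= wnorm D W g)%E.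
Proof.
move=> Ww W'W fg; apply: le_esum => s _; rewrite lee_fin.
by case/andP: (W'W s) => W0 WW; apply: ler_pM => //; exact: nrm_ge0.
Qed.

Lemma wnormD W f g : is_weight W ->
  (wnorm setT W (f + g)%R <= wnorm setT W f + wnorm setT W g)%E.
Proof.
move=> Ww; rewrite -esumD => [|s _|s _]; [|exact: wterm_ge0..].
apply: le_esum => s _; rewrite -EFinD lee_fin -mulrDr ler_wpM2l ?weight_ge0 //.
exact: nrmD.
Qed.

Lemma wnormN W f : wnorm setT W (- f)%R = wnorm setT W f.
Proof.
apply: eq_esum => s _; rewrite -[(- f) s]/(- f s).
by rewrite (normcN (f s : Rcomplex R)).
Qed.

Lemma wterm_mul W f g s : is_weight W ->
  W s * nrm ((f * g) s) <=
  \sum_(i < (size s).+1) (W (take i s) * nrm (f (take i s))) *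
                         (W (drop i s) * nrm (g (drop i s))).
Proof.
move=> Ww; rewrite wmulE; apply: le_trans (_ : W s * _ <= _).
  by apply: ler_wpM2l; [exact: weight_ge0 | exact: nrm_sum].
rewrite mulr_sumr; apply: ler_sum => i _; rewrite mulrACA.
rewrite ComplexField.Normc.normcM ler_wpM2r ?mulr_ge0 ?nrm_ge0 //.
by case: Ww => _ Wm; rewrite -{1}(cat_take_drop i s).
Qed.

Lemma esum_mul_le (a b : word -> R) (x : R) : (forall s, 0 <= a s) ->
  (forall s, 0 <= b s) -> (\esum_(s in setT) (b s)%:E <= x%:E)%E ->
  (\esum_(u in setT) \esum_(v in setT) (a u * b v)%R%:E <=
   x%:E * \esum_(u in setT) (a u)%:E)%E.
Proof.
move=> a0 b0 bx; have x0 : 0 <= x.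
  by rewrite -lee_fin (le_trans _ bx) // esum_ge0 // => s _; rewrite lee_fin.
apply: le_trans (esumZl_le _ x0 _); last by move=> s; rewrite lee_fin.
apply: le_esum => u _; under eq_esum => v _ do rewrite EFinM.
apply: le_trans (esumZl_le _ (a0 u) _) _; first by move=> s; rewrite lee_fin.
by rewrite muleC; apply: lee_wpmul2r => //; rewrite lee_fin.
Qed.

Lemma wnormM W f g (x : R) : is_weight W -> (wnorm setT W g <= x%:E)%E ->
  (wnorm setT W (f * g)%R <= x%:E * wnorm setT W f)%E.
Proof.
move=> Ww gx; have t0 h s : 0 <= W s * nrm (h s).
  by rewrite mulr_ge0 ?nrm_ge0 ?weight_ge0.
apply: le_trans (esum_mul_le (t0 f) (t0 g) gx).
rewrite -esum_take_drop; last by move=> u v; rewrite lee_fin mulr_ge0.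
by apply: le_esum => s _; rewrite sumEFin lee_fin; exact: wterm_mul.
Qed.

Lemma wnorm_1D W f : is_weight W -> W [::] = 1 -> f [::] = 1 ->
  wnorm setT W f = (1 + wnorm setT W (f - 1)%R)%E.
Proof.
move=> Ww W1 f1; have -> : 1%E = (\esum_(s in setT) (s == [::] :> word)%:R%:E)%E :> \bar R.
  rewrite -(@esum_set1 _ _ [::] (fun _ : word => 1%E)) // esum_mkcond.
  by apply: eq_esum => s _; case: eqP => [->|s0]; [rewrite mem_set|rewrite memNset].
rewrite -esumD => [|s _|s _]; [|by rewrite lee_fin ler0n|exact: wterm_ge0].
apply: eq_esum => s _; rewrite -EFinD; congr (_%:E).
rewrite -[(f - 1) s]/(f s - (s == [::])%:R); case: eqP => [->|_]; last first.
  by rewrite subr0 add0r.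
by rewrite f1 subrr W1 ComplexField.Normc.normc1 ComplexField.Normc.normc0 mulr0 addr0 mul1r.
Qed.

(* Truncating [f^-1] at words of length [< N], the equation
   [f^-1 = 1 - (f - 1) f^-1] bounds the norm by induction on [N]. *)
Lemma wnormV W f (c : R) : is_weight W -> W [::] = 1 -> f [::] = 1 -> c < 1 ->
  (wnorm setT W (f - 1)%R <= c%:E)%E -> (wnorm setT W (f^-1)%R <= ((1 - c)^-1)%R%:E)%E.
Proof.
move=> Ww W1 f1 c1 fc; set h := f^-1.
have c0 : 0 <= c by rewrite -lee_fin (le_trans _ fc) // wnorm_ge0.
(* [(1 - c)^-1] is the fixed point of [x |-> 1 + x c], hence a bound that reproduces itself in the
   induction. *)
have cV : 1 + (1 - c)^-1 * c = (1 - c)^-1.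
  have c1' : 1 - c != 0 by rewrite subr_eq0 eq_sym lt_eqF.
  by apply: (mulfI c1'); rewrite mulrDr mulrA divff // mulr1 mul1r subrK.
have uf : f \is a GRing.unit by rewrite wunitE f1 oner_neq0.
have hE : h = 1 - (f - 1) * h by rewrite mulrBl divrr // mul1r opprB addrC subrK.
pose t (g : wseries R[i]) s := W s * nrm (g s).
have t0 g s : 0 <= t g s by rewrite mulr_ge0 ?nrm_ge0 ?weight_ge0.
pose th N s := if (size s < N)%N then t h s else 0.
have th0 N s : 0 <= th N s by rewrite /th; case: ifP.
have step N s : th N.+1 s <= (s == [::])%:R +
    \sum_(i < (size s).+1) t (f - 1) (take i s) * th N (drop i s).
  rewrite /th; case: ifP => sN; last first.
    by rewrite addr_ge0 ?ler0n ?sumr_ge0 // => i _; rewrite mulr_ge0 // /th; case: ifP.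
  have -> : t h s = W s * nrm ((s == [::])%:R - ((f - 1) * h) s).
    by rewrite /t {1}hE.
  apply: le_trans (_ : W s * (nrm ((s == [::])%:R : R[i]) + nrm (((f - 1) * h) s)) <= _).
    apply: ler_wpM2l; first exact: weight_ge0.
    by apply: le_trans (nrmD _ _) _; rewrite (normcN (((f - 1) * h) s : Rcomplex R)).
  rewrite mulrDr lerD //.
    case: eqP => [->|_]; first by rewrite W1 ComplexField.Normc.normc1 mulr1.
    by rewrite ComplexField.Normc.normc0 mulr0.
  apply: le_trans (wterm_mul _ _ _ Ww) _; apply: ler_sum => i _.
  (* Only [i = 0] leaves a remainder not shorter than [N], and there the coefficient of [f - 1] is
     0. *)
  case: (ifP (size (drop i s) < N)%N) => // /negbT dN.
  have i0 : nat_of_ord i = 0%N.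
    apply/eqP; rewrite -leqn0 leqNgt; apply: contra dN => i0.
    rewrite size_drop -ltnS; apply: leq_trans sN; rewrite ltnS.
    by rewrite ltn_subrL i0 /=; case: (s) i i0 => [[[]]|].
  rewrite i0 take0 -[(f - 1) [::]]/(f [::] - 1) f1 subrr.
  by rewrite ComplexField.Normc.normc0 mulr0 !mul0r mulr0.
have bd N : (\esum_(s in setT) (th N s)%:E <= ((1 - c)^-1)%R%:E)%E.
  elim: N => [|N IH].
    by rewrite esum1 // lee_fin invr_ge0 subr_ge0 ltW.
  rewrite -cV EFinD EFinM.
  apply: le_trans (_ : (\esum_(s in setT) ((s == [::] :> word)%:R%:E +
    \sum_(i < (size s).+1) (t (f - 1) (take i s) * th N (drop i s))%R%:E) <= _)%E).
    by apply: le_esum => s _; rewrite sumEFin -EFinD lee_fin step.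
  rewrite esumD => [|s _|s _]; [|by rewrite lee_fin ler0n|]; last first.
    by rewrite sumEFin lee_fin sumr_ge0 // => i _; rewrite mulr_ge0.
  apply: leeD.
    rewrite -(@esum_set1 R _ [::] (fun _ : word => 1%E)) // [leRHS]esum_mkcond.
    by apply: le_esum => s _; case: eqP => [->|s0]; [rewrite mem_set|rewrite memNset].
  rewrite (esum_take_drop (a := fun u v => (t (f - 1) u * th N v)%R%:E)); last first.
    by move=> u v; rewrite lee_fin mulr_ge0.
  apply: le_trans (esum_mul_le (t0 (f - 1)) (th0 N) IH) _.
  by apply: lee_wpmul2l => //; rewrite lee_fin invr_ge0 subr_ge0 ltW.
(* The norm is a supremum of finite sums, and the words in a finite set have bounded length. *)
apply: ge_ereal_sup => _ [X [finX _]] <-.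
have [N XN] : exists N, forall s, X s -> (size s < N)%N.
  have /finite_seqP[l ->] := finX.
  exists (\max_(s <- l) size s).+1 => s /= sl; rewrite ltnS.
  by rewrite (big_rem s) //= leq_maxl.
apply: le_trans (bd N); apply: esum_ge; exists X => //.
rewrite !fsbig_finite // big_seq [leRHS]big_seq; apply: lee_sum => s.
by rewrite in_fset_set // inE => /XN sN; rewrite /th sN.
Qed.

End WeightedNormTheory.

(** * The weighted norm of f_{*g} *)

Section StarBound.
Variable R : realType.
Variables (W : word -> R) (Q : R) (g : wseries R[i]).
Hypothesis Ww : is_weight W.
Hypothesis (Wcyc : forall s t : word, W (s ++ t) = W (t ++ s)).
Hypotheses (Q1 : 1 <= Q) (g1 : g [::] = 1) (gQ : (wnorm setT W g <= Q%:E)%E).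
Implicit Types f : wseries R[i].
Local Notation nrm := ComplexField.Normc.normc.
Local Notation cw s := (count_mem Lw s).
Local Notation words_w m := [set s : word | cw s = m]%classic.

Let Q0 : 0 < Q. Proof. exact: lt_le_trans ltr01 Q1. Qed.

(** Rotating the word brings [u] to the front, where submultiplicativity splits it off. *)
Lemma weight_insert s u t : W (s ++ u ++ t) <= W u * W (s ++ t).
Proof.
case: Ww => _ Wm; rewrite Wcyc -catA; apply: le_trans (Wm _ _) _.
by rewrite (Wcyc t s).
Qed.

Lemma wtilde_le s : 0 <= wtilde W Q s <= W s.
Proof.
rewrite /wtilde mulr_ge0 ?weight_ge0 ?invr_ge0 ?exprn_ge0 ?(ltW Q0) //=.
rewrite ler_piMr ?weight_ge0 // invf_le1 ?exprn_gt0 //; exact: exprn_ege1.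
Qed.

Lemma wtilde_weight : is_weight (wtilde W Q).
Proof.
case: Ww => W0 Wm; split=> [s|s t]; first by rewrite divr_gt0 // exprn_gt0.
rewrite /wtilde count_cat exprD invfM mulrACA ler_wpM2r //.
by rewrite mulr_ge0 // invr_ge0 exprn_ge0 // ltW.
Qed.

Lemma zpow_inj : injective zpow.
Proof. by move=> n m /(congr1 size); rewrite !size_nseq. Qed.

Lemma esum_words_w0 (F : word -> \bar R) :
  (\esum_(s in words_w 0%N) F s = \esum_(n in setT) F (zpow n))%E.
Proof.
rewrite (reindex_esum setT _ zpow) //; split => [n _|n m _ _ /zpow_inj //|s /=].
  exact: cw_zpow.
case: (word_gap s) => [[n ->] _|[n [t ->]]]; first by exists n.
by rewrite count_cat /= addnCA.
Qed.

Lemma gap_inj n t n' t' :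
  zpow n ++ Lw :: t = zpow n' ++ Lw :: t' -> n = n' /\ t = t'.
Proof.
by elim: n n' => [|n IH] [|n'] //= [] => [->|/IH[-> ->]].
Qed.

Lemma esum_words_wS m (F : word -> \bar R) : (forall s, 0 <= F s)%E ->
  (\esum_(s in words_w m.+1) F s =
   \esum_(n in setT) \esum_(t in words_w m) F (zpow n ++ Lw :: t))%E.
Proof.
move=> F0; rewrite esum_esum //.
rewrite (reindex_esum ([set: nat] `*`` (fun=> words_w m))%classic _
  (fun p => zpow p.1 ++ Lw :: p.2)) //; split=> [[n t] [_ /= tm]|[n t] [n' t'] _ _|s /=].
- by rewrite count_cat cw_zpow /= tm.
- by move=> /gap_inj[/= -> ->].
case: (word_gap s) => [[n ->]|[n [t ->]]]; first by rewrite cw_zpow.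
rewrite count_cat cw_zpow /= add0n add1n => -[tm].
by exists (n, t).
Qed.

(** Induction on the number of letters [w]. Stripping the first [z^k w] moves it from the word into
    the prefix [a] of the weight; hence the statement for all [a]. *)
Lemma fstar_bound_words m a f :
  (\esum_(s in words_w m) (W (a ++ s) * Q ^- m * nrm (fstar f g s))%R%:E <=
   \esum_(s in words_w m) (W (a ++ s) * nrm (f s))%R%:E)%E.
Proof.
elim: m a f => [|m IH] a f.
  rewrite !esum_words_w0; apply: le_esum => n _.
  by rewrite fstar_zword expr0 invr1 mulr1.
have Wa0 s : 0 <= W s by exact: weight_ge0.
have QV0 j : 0 <= Q ^- j by rewrite invr_ge0 exprn_ge0 // ltW.
have F0 s : (0 <= (W (a ++ s) * nrm (f s))%R%:E)%E.
  by rewrite lee_fin mulr_ge0 ?nrm_ge0.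
have F0' s : (0 <= (W (a ++ s) * Q ^- m.+1 * nrm (fstar f g s))%R%:E)%E.
  by rewrite lee_fin !mulr_ge0 ?nrm_ge0.
rewrite !esum_words_wS //.
(* [b] gathers the factor of [g] from the first gap and the [Q^-1] of the first [w]; [d] is what
   remains for the induction. *)
pose b l := W (zpow l) * nrm (g (zpow l)) / Q.
pose d k t := W (a ++ zpow k ++ Lw :: t) * Q ^- m *
  nrm (fstar (fun s => f (zpow k ++ Lw :: s)) g t).
have b0 l : 0 <= b l by rewrite divr_ge0 ?mulr_ge0 ?nrm_ge0 // ltW.
have d0 k t : 0 <= d k t by rewrite !mulr_ge0 ?nrm_ge0.
apply: le_trans (_ : (\esum_(n in setT) \esum_(t in words_w m)
    \sum_(k < n.+1) (b (n - k)%N * d k t)%R%:E <= _)%E).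
  apply: le_esum => n _; apply: le_esum => t _; rewrite sumEFin lee_fin fstar_gap //.
  apply: le_trans (ler_wpM2l _ (nrm_sum _ _)) _; first by rewrite mulr_ge0.
  rewrite mulr_sumr; apply: ler_sum => k _; have kn : (k <= n)%N by rewrite -ltnS.
  rewrite ComplexField.Normc.normcM /b /d exprS invfM.
  set x := nrm (fstar _ _ _); set y := nrm (g _).
  have x0 : 0 <= x by exact: nrm_ge0.
  have y0 : 0 <= y by exact: nrm_ge0.
  have -> : W (zpow (n - k)) * y / Q * (W (a ++ zpow k ++ Lw :: t) * Q ^- m * x) =
      W (zpow (n - k)) * W (a ++ zpow k ++ Lw :: t) * (Q^-1 * Q ^- m * (x * y)) by ring.
  rewrite -[leLHS]mulrA; apply: ler_wpM2r.
    by rewrite !mulr_ge0 // invr_ge0 ltW.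
  (* Cyclic invariance enters here: the [n - k] letters read by [g] stand inside the word, after
     [a ++ zpow k]. *)
  rewrite [a ++ zpow k ++ _]catA; apply: le_trans (weight_insert _ _ _).
  by rewrite -[in leLHS](subnKC kn) /zpow nseqD -!catA.
apply: le_trans (_ : (\esum_(n in setT) \sum_(k < n.+1)
    \esum_(t in words_w m) (b (n - k)%N * d k t)%R%:E <= _)%E).
  by apply: le_esum => n _; rewrite esum_sum // => t k _ _; rewrite lee_fin mulr_ge0.
rewrite (esum_cauchy (a := fun k l => \esum_(t in words_w m) (b l * d k t)%R%:E)%E); last first.
  by move=> k l; apply: esum_ge0 => t _; rewrite lee_fin mulr_ge0.
apply: le_esum => k _; rewrite exchange_esum; last by move=> l t; rewrite lee_fin mulr_ge0.
have bE : (\esum_(l in setT) (b l)%:E <= 1)%E.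
  apply: le_trans (_ : (\esum_(l in setT) (Q^-1)%R%:E *
      (W (zpow l) * nrm (g (zpow l)))%R%:E <= _)%E).
    by apply: le_esum => l _; rewrite -EFinM lee_fin /b mulrC.
  apply: le_trans (esumZl_le _ _ _) _.
  - by rewrite invr_ge0 ltW.
  - by move=> l; rewrite lee_fin mulr_ge0 ?nrm_ge0.
  rewrite -(esum_words_w0 (fun s => (W s * nrm (g s))%R%:E)).
  apply: le_trans (_ : ((Q^-1)%R%:E * Q%:E <= _)%E); last first.
    by rewrite -EFinM mulVf ?gt_eqF.
  apply: lee_wpmul2l; first by rewrite lee_fin invr_ge0 ltW.
  by apply: le_trans gQ; apply: esum_subset.
apply: (le_trans (le_trans _ (IH (a ++ zpow k ++ [:: Lw]) (fun s => f (zpow k ++ Lw :: s))))); last first.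
  by apply: le_esum => t _; rewrite -!catA.
apply: le_esum => t _.
under eq_esum => l _ do rewrite mulrC EFinM.
apply: le_trans (esumZl_le _ (d0 k t) _) _; first by move=> l; rewrite lee_fin.
rewrite -!catA /= -/(d k t) -[leRHS]mule1; apply: lee_wpmul2l => //.
by rewrite lee_fin.
Qed.

(** Words are grouped by their number [m] of letters [w], on which [wtilde W Q] is [W] times the
    constant [Q ^- m]. *)
Lemma wnorm_fstar f : (wnorm setT (wtilde W Q) (fstar f g) <= wnorm setT W f)%E.
Proof.
have -> : (setT : set word) = (\bigcup_(m in setT) words_w m)%classic.
  by rewrite eqEsubset; split => // s _; exists (cw s).
have tw : trivIset setT (fun m => words_w m) by move=> i j _ _ [s [/= <- <-]].
rewrite /wnorm [leLHS]esum_bigcupT //; last first.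
  by move=> s; apply: wterm_ge0; exact: wtilde_weight.
rewrite esum_bigcupT // => [|s]; last exact: wterm_ge0.
apply: le_esum => m _; apply: le_trans (fstar_bound_words m [::] f).
by apply: le_esum => s /= sm; rewrite /wtilde sm.
Qed.

End StarBound.

Theorem corollary7p5 (R : realType) (phi : {scalar Balg R})
    (L : word -> R[i]) (W : word -> R) (Q : R) :
  let M := moment phi in
  let Mzw := Mgf M in
  let Lzw := Lgf L in
  let Mz0 := zpart Mzw in
  let Lz0 := zpart Lzw in
  let Ms := Mstar M in
  let W' := wtilde W Q in
  is_state phi ->
  is_cumulants M L ->
  is_weight W ->
  W [::] = 1 ->
  (forall s t : word, W (s ++ t) = W (t ++ s)) ->
  2^-1 < Q ->
  (wnorm setT W Mzw < (2 - Q^-1)%:E)%E ->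
  l1 Sz W Lz0 ->
  [/\ [/\ l1 setT W' Lzw, l1 setT W' Lz0, l1 setT W' Ms,
          l1 setT W' Mz0 & l1 setT W' Ms^-1]
    & Lzw = Lz0 + (Ms - Mz0) * Ms^-1].
Proof.
move=> M Mzw Lzw Mz0 Lz0 Ms W' [phi1 _] ML Ww W1 Wcyc Q2 MQ LzW.
have M1 : M [::] = 1 by rewrite /M /moment big_nil.
have LE : Lzw = Lz0 + (Ms - Mz0) * Ms^-1 by exact: Lgf_Mstar.
have Mzw1 : Mzw [::] = 1 by exact: Mgf1.
have Q0 : 0 < Q by apply: lt_trans Q2; rewrite invr_gt0 ltr0n.
have := MQ; rewrite (wnorm_1D Ww W1 Mzw1).
have dge0 := wnorm_ge0 (Mzw - 1) setT Ww.
(* An infinite norm of [Mzw - 1] would contradict the bound on that of [Mzw]. *)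
case dE : (wnorm setT W (Mzw - 1)%R) dge0 => [c| |] // c0.
rewrite lee_fin in c0; rewrite -EFinD lte_fin => cQ.
have {}cQ : c < 1 - Q^-1 by lra.
have QV : 0 < Q^-1 by rewrite invr_gt0.
have c1 : c < 1 by lra.
(* As [0 <= c < 1 - Q^-1], also [Q^-1 < 1]. *)
have Q1 : 1 <= Q by rewrite -(invrK Q) invf_ge1 //; lra.
have Mz01 : Mz0 [::] = 1 by rewrite /Mz0 /zpart.
(* Restriction to S(z) only drops terms, so [Mz0 - 1] has norm at most [c] as well. *)
have gV : (wnorm setT W (Mz0^-1)%R <= ((1 - c)^-1)%R%:E)%E.
  apply: wnormV => //; rewrite -dE; apply: le_wnorm => // s.
    by rewrite lexx weight_ge0.
  rewrite -[(Mz0 - 1) s]/(Mz0 s - (s == [::])%:R) -[(Mzw - 1) s]/(Mzw s - (s == [::])%:R).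
  rewrite /Mz0 /zpart; case: ifP => // zs.
  case: eqP zs => [-> //|_ _]; rewrite subr0 ComplexField.Normc.normc0; exact: nrm_ge0.
have gQ : (wnorm setT W (Mz0^-1)%R <= Q%:E)%E.
  apply: le_trans gV _; rewrite lee_fin -[leRHS]invrK lef_pV2 ?posrE ?subr_gt0 //.
  by lra.
have W'w : is_weight W' by exact: wtilde_weight.
have W'W s : 0 <= W' s <= W s by exact: wtilde_le.
have W'1 : W' [::] = 1 by rewrite /W' /wtilde W1 expr0 invr1 mulr1.
have g1 : (Mz0^-1) [::] = 1 by exact: gz1.
have MsM : (wnorm setT W' Ms <= wnorm setT W Mzw)%E by exact: wnorm_fstar.
have lMs : l1 setT W' Ms by apply: le_lt_trans MsM (lt_trans MQ (ltry _)).
have Ms1 : Ms [::] = 1 by exact: Mstar1.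
(* [wnorm_fstar] bounds the norm of [Ms] by [1 + c]; both series have constant term 1, so [Ms - 1]
   has norm at most [c]. *)
have MsV : (wnorm setT W' (Ms^-1)%R <= ((1 - c)^-1)%R%:E)%E.
  apply: wnormV => //; move: MsM; rewrite (wnorm_1D W'w W'1 Ms1) (wnorm_1D Ww W1 Mzw1) dE.
  by rewrite leeD2lE.
have lMsV : l1 setT W' Ms^-1 by apply: le_lt_trans MsV (ltry _).
have lMz0 : l1 setT W' Mz0.
  apply: le_lt_trans (lt_trans MQ (ltry _)); apply: le_wnorm => // s.
  by rewrite /Mz0 /zpart; case: ifP => // _; rewrite ComplexField.Normc.normc0 nrm_ge0.
have lLz0 : l1 setT W' Lz0.
  apply: le_lt_trans (_ : (wnorm setT W Lz0 < _)%E); first exact: le_wnorm.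
  (* The hypothesis sums over S(z) only; [zpart] vanishes on the other words. *)
  apply: le_lt_trans LzW; rewrite /wnorm [leRHS]esum_mkcond.
  apply: le_esum => s _; rewrite /Sz; case: (boolP (zword s)) => zs; first by rewrite mem_set.
  rewrite memNset /=; last exact/negP.
  by rewrite /Lz0 /zpart (negbTE zs) ComplexField.Normc.normc0 mulr0.
split => //; split => //.
(* Membership of [Lzw] is read off the identity, as the norms on its right-hand side are under
   control. *)
rewrite LE; apply: le_lt_trans (wnormD _ _ W'w) _; apply: lte_add_pinfty => //.
apply: le_lt_trans (wnormM _ W'w MsV) _.
have : (wnorm setT W' (Ms - Mz0)%R < +oo)%E.
  apply: le_lt_trans (wnormD _ _ W'w) _; apply: lte_add_pinfty => //.
  by rewrite wnormN.
have := wnorm_ge0 (Ms - Mz0) setT W'w.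
by case: (wnorm _ _ _) => // x _ _; rewrite -EFinM ltry.
Qed.
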